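(* Let $n,k$ be integers with $1\le k\le n$. There are constants $C_1,C_2>0$ depending only on $n$ and $k$ such that the following holds. Let $\mathbf{k}$ be an arbitrary field, let $m$ be a positive integer, and let $S$ be a $0$-dimensional subscheme of $\mathbb{A}^n/\mathbf{k}$ supported at the origin and defined by a homogeneous ideal. Let $X^S_{m,k}\subseteq \operatorname{Gr}(k,n)$ be the moduli scheme of directions of $m$-rich $k$-planes for $S$. Then either: (1) $X^S_{m,k}=\operatorname{Gr}(k,n)$ and $|S|\ge C_1 m^{n/k}$; or (2) $\Sigma^S_{2m,k}$ is contained in a hypersurface $Z\subseteq\operatorname{Gr}(k,n)$ of degree at most $C_2\frac{|S|}{m}$.
   Context: Let $S=\operatorname{Spec}A$ with $A=\mathbf{k}[x_1,\dots,x_n]/I_S$ finite-dimensional over $\mathbf{k}$, and $|S|:=\dim_{\mathbf{k}}A=:N$. For an affine $k$-plane $V\subset\mathbb{A}^n$ cut out by polynomials $\ell_1,\dots,\ell_{n-k}$ of degree one, $S\cap V$ is the scheme-theoretic intersection $\operatorname{Spec}\mathbf{k}[x_1,\dots,x_n]/(I_S+(\ell_1,\dots,\ell_{n-k}))$, $|S\cap V|$ is the $\mathbf{k}$-dimension of its coordinate ring, and $V$ is $m$-rich for $S$ if $|S\cap V|\ge m$. $\operatorname{Gr}(k,n)$ is the Grassmannian over $\mathbf{k}$ of $k$-dimensional linear subspaces (directions of $k$-planes) of $\mathbb{A}^n$. $\Sigma^S_{m,k}\subseteq\operatorname{Gr}(k,n)(\mathbf{k})$ is the set of directions $\omega$ such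 that some $k$-plane $V$ in direction $\omega$ satisfies $|S\cap V|\ge m$. The scheme $X^S_{m,k}$: let $W=\langle x_1,\dots,x_n\rangle$ be the space of linear forms and $\mathcal{S}\subset\mathcal{O}_{\operatorname{Gr}}\otimes W$ the tautological subbundle of rank $n-k$ whose fiber at $[V]$ is the space of linear forms vanishing on $V$. Multiplication $\ell\otimes a\mapsto \ell a$ gives a map of vector bundles $\overline{\Phi}:\mathcal{S}\otimes_{\mathbf{k}}A\to\mathcal{O}_{\operatorname{Gr}}\otimes_{\mathbf{k}}A$ on $\operatorname{Gr}(k,n)$, of ranks $(n-k)N$ and $N$. $X^S_{m,k}$ is the closed subscheme of $\operatorname{Gr}(k,n)$ defined by the $(N-m+1)\times(N-m+1)$ minors of $\overline{\Phi}$ (the unit ideal if $N-m+1\le 0$). Its $\mathbf{k}$-points are exactly $\Sigma^S_{m,k}$; and $X^S_{m,k}=\operatorname{Gr}(k,n)$ means that every $k$-plane through the origin, including those defined over field extensions of $\mathbf{k}$, is $m$-rich for $S$. A hypersurface of degree $d$ in $\operatorname{Gr}(k,n)$ is the zero locus of a nonzero homogeneous element of degree $d$ in the homogeneous coordinate ring of $\operatorname{Gr}(k,n)$ in its Plücker embedding ($d=0$ allowed, in which case the zero locus is empty). *)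

(* Defs.v *)
From mathcomp Require Import all_boot all_order perm all_algebra.
From mathcomp Require Import mpoly.

Set Implicit Arguments.
Unset Strict Implicit.
Unset Printing Implicit Defensive.

Import GRing.Theory.
Local Open Scope ring_scope.

Section FiniteSchemes.

Variables (F : fieldType) (n : nat).
Implicit Types I : {mpoly F[n]} -> Prop.

(* The unit ideal (the empty scheme) is allowed. *)
Definition is_ideal I : Prop :=
  [/\ I 0, forall p q, I p -> I q -> I (p + q) & forall p q, I q -> I (p * q)].

Definition homogeneous_ideal I : Prop :=
  is_ideal I /\ forall (d : nat) p, I p -> I (pihomog mdeg d p).

(* The support of Spec F[x]/I is at most the origin: every prime containing I
   contains (x_1, ..., x_n), that is, each x_j lies in the radical of I. *)
Definition supported_at_origin I : Prop :=
  forall j : 'I_n, exists e : nat, I ('X_j ^+ e).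

(* A finite basis of the F-vector space F[x]/I: representatives qbasis of its
   elements, together with the coordinate map F[x] -> F[x]/I = F^N. *)
Record quot_basis I (N : nat) := QuotBasis {
  qcoord : {linear {mpoly F[n]} -> 'rV[F]_N};
  qbasis : 'I_N -> {mpoly F[n]};
  qcoord_basis : forall a, qcoord (qbasis a) = delta_mx 0 a;
  qcoord_ker : forall p, I p <-> qcoord p = 0
}.

(* dim_F F[x]/I = N *)
Definition quot_dim I (N : nat) : Prop := inhabited (quot_basis I N).

(* I + (l_1, ..., l_r) *)
Definition ideal_add I (r : nat) (l : 'I_r -> {mpoly F[n]}) :
    {mpoly F[n]} -> Prop :=
  fun p => exists (a : {mpoly F[n]}) (q : 'I_r -> {mpoly F[n]}),
    I a /\ p = a + \sum_(i < r) q i * l i.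

(* The degree-one polynomials l_i = \sum_j L_ij x_j + c_i; when L is row-free
   they cut out the affine plane {v | L v + c = 0}, whose direction is the
   kernel of L. *)
Definition plane_eqn (r : nat) (L : 'M[F]_(r, n)) (c : 'cV[F]_r) (i : 'I_r) :
    {mpoly F[n]} :=
  \sum_(j < n) L i j *: 'X_j + (c i 0)%:MP.

Definition rich_plane I (m r : nat) (L : 'M[F]_(r, n)) (c : 'cV[F]_r) : Prop :=
  exists d : nat, quot_dim (ideal_add I (plane_eqn L c)) d /\ (m <= d)%N.

(* An F-point of Gr(k, n) is given by a row-free k x n matrix w, standing for
   its row space; Sigma below and zeros_on_Gr depend only on that row space. *)
Definition Sigma I (m k : nat) (w : 'M[F]_(k, n)) : Prop :=
  row_free w /\
  exists (L : 'M[F]_(n - k, n)) (c : 'cV[F]_(n - k)),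
    [/\ row_free L, (w == kermx L^T)%MS & rich_plane I m L c].

End FiniteSchemes.

Section RichDirections.

Variables (F : fieldType) (n k m : nat) (hkn : (k <= n)%N).

(* Gr(k, n) is covered by affine charts U_s = A^((n-k)k), s ranging over the
   permutations of the coordinates (charts are repeated; this is harmless). *)
Local Notation chart_ring := {mpoly F[(n - k) * k]}.

(* The frame of the tautological subbundle of linear forms on the chart U_s:
   the rows of (1 | Y) with columns permuted by s, where Y is the
   (n-k) x k matrix of the chart coordinates. *)
Definition taut_mx (s : 'S_n) : 'M[chart_ring]_(n - k, n) :=
  \matrix_(i, j)
    match split (cast_ord (esym (subnK hkn)) (s j)) with
    | inl a => (i == a)%:R
    | inr b => 'X_(mxvec_index i b)
    end.

Variables (I : {mpoly F[n]} -> Prop) (N : nat) (A : quot_basis I N).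

(* The matrix on U_s of the multiplication map S (x) A -> O (x) A: the
   coordinates of l_i * b_a, for l_i the i-th form of the frame and b_a the
   a-th element of the basis of A = F[x]/I. *)
Definition Phi (s : 'S_n) (ia : 'I_(n - k) * 'I_N) (b : 'I_N) :
    chart_ring :=
  \sum_(j < n) taut_mx s ia.1 j * (qcoord A ('X_j * qbasis A ia.2) 0 b)%:MP.

(* N.+1 - m is N - m + 1 if m <= N.+1, and 0 otherwise; in size 0 the only
   minor is 1, which yields the unit ideal. *)
Definition minor_size : nat := N.+1 - m.

Definition Phi_minor (s : 'S_n)
    (fg : {ffun 'I_minor_size -> 'I_(n - k) * 'I_N} *
          {ffun 'I_minor_size -> 'I_N}) : chart_ring :=
  \det (\matrix_(p < minor_size, q < minor_size) Phi s (fg.1 p) (fg.2 q)).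

(* The ideal of X in the coordinate ring of U_s.  Minors with repeated rows or
   columns vanish and reorderings change signs only, so that arbitrary
   selections of rows and columns give the same ideal; nor does it depend on
   the choice of the basis of A. *)
Definition X_ideal (s : 'S_n) (p : chart_ring) : Prop :=
  exists c : {ffun 'I_minor_size -> 'I_(n - k) * 'I_N} *
             {ffun 'I_minor_size -> 'I_N} -> chart_ring,
    p = \sum_fg c fg * Phi_minor s fg.

(* Equality of schemes X = Gr(k, n): the ideal sheaf of X vanishes. *)
Definition X_is_Gr : Prop :=
  forall (s : 'S_n) (p : chart_ring), X_ideal s p -> p = 0.

End RichDirections.

Section Plucker.

Variables (n k : nat).

(* Increasing sequences of k column indices. *)
Definition plucker_index :=
  {f : {ffun 'I_k -> 'I_n} | 
    [forall i : 'I_k, forall j : 'I_k, (i < j)%N ==> (f i < f j)%N]}.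

Definition plucker (R : comNzRingType) (B : 'M[R]_(k, n))
    (i : 'I_#|{: plucker_index}|) : R :=
  \det (colsub (val (enum_val i)) B).

Variable F : fieldType.

Definition generic_mx : 'M[{mpoly F[k * n]}]_(k, n) :=
  \matrix_(i, j) 'X_(mxvec_index i j).

(* The homogeneous coordinate ring of Gr(k, n) is F[p_J]/P, where P, the ideal
   of Pluecker relations, is the kernel of the map sending p_J to the J-th
   maximal minor of the generic k x n matrix.  Its elements of degree d are
   represented by the homogeneous G of degree d in F[p_J], and G represents a
   nonzero one when its image under that map is nonzero. *)
Definition Gr_hypersurface (d : nat)
    (G : {mpoly F[#|{: plucker_index}|]}) : Prop :=
  G \is d.-homog /\
  mmap (@mpolyC (k * n) F) (plucker generic_mx) G <> 0.

Definition zeros_on_Gr (G : {mpoly F[#|{: plucker_index}|]})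
    (w : 'M[F]_(k, n)) : Prop :=
  row_free w /\ G.@[plucker w] = 0.

End Plucker.

(* Main.v *)
(** Write Phi for the multiplication map of the statement and D = (n - k) k.

    Suppose first that some minor of Phi of size N - m + 1 is nonzero on a chart.
    It has degree at most N and vanishes to order more than m at the points of
    Sigma_2m, where the rank of Phi drops to N - 2 m. A characteristic-free
    argument in the style of Waldschmidt and Skoda (interpolation at a set of
    points on which no polynomial of low degree vanishes, against a dimension
    count) then gives a nonzero polynomial of degree O(N / m) vanishing at these
    points. It is homogenized through the Pluecker coordinates of the chart and
    multiplied by the one that vanishes outside of the chart.

    Otherwise the generic plane, defined over K = F(Y) by forms l_i, is m-rich:
    B = A_K / (l_1, ..., l_(n-k)) has dimension at least m. Let T be the set of
    standard monomials of B for the degree-lexicographic order, a down-closed set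
    of at least m monomials in k variables. When r is a small multiple of
    m^(1/k), at least half of the elements of T stay in T when multiplied by
    x_b^R for some b, with R of order r. For these mu, the products l^alpha x^mu,
    with all alpha_i < r, are linearly independent in A_K: in a relation with
    polynomial coefficients c(Y), replace Y_ib by Y_ib + e_i for a fixed b, so
    that l_i becomes l_i + e_i x_b, and reduce modulo the l_i. The part of lowest
    order in e shows that x_b^|alpha| kills sum_mu c_(alpha, mu) x^mu in B, for
    every b and an alpha of minimal degree, which contradicts the choice of the
    leading mu. Hence N >= r^(n-k) m / 2. *)
From HB Require Import structures.
Require Import Defs.
From mathcomp Require Import all_boot all_order all_algebra.
From mathcomp Require Import mpoly.
From mathcomp Require Import reals exp.
From mathcomp Require Import perm zify.
From mathcomp Require Import boolp.
Import Order.TTheory GRing.Theory Num.Theory.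
Local Open Scope ring_scope.

Set Implicit Arguments.
Unset Strict Implicit.
Unset Printing Implicit Defensive.

Local Notation tofrac := (@FracField.tofrac _).

(** * Degrees and orders of vanishing *)

Lemma linear_dependence (K : fieldType) (J X : finType) (a : J -> X -> K) :
  (#|X| < #|J|)%N ->
  exists2 c : J -> K, (exists j, c j != 0) &
    forall x, \sum_j c j * a j x = 0.
Proof.
move=> ltXJ.
pose M : 'M[K]_(#|J|, #|X|) := \matrix_(i, j) a (enum_val i) (enum_val j).
have: kermx M != 0.
  rewrite -mxrank_eq0 mxrank_ker subn_eq0 -ltnNge.
  exact: leq_ltn_trans (rank_leq_col M) ltXJ.
case/rowV0Pn => v /sub_kermxP vM v0.
exists (fun j => v 0 (enum_rank j)).
  case/rV0Pn: v0 => i vi; exists (enum_val i); by rewrite enum_valK.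
move=> x; have /matrixP/(_ 0 (enum_rank x)) := vM.
rewrite !mxE; apply: etrans.
rewrite (reindex (@enum_val _ J)) /=; last first.
  by exists enum_rank => j _; rewrite ?enum_valK ?enum_rankK.
by apply: eq_bigr => i _; rewrite mxE enum_valK enum_rankK.
Qed.

Section BoxDegree.
Variables (R : comNzRingType) (D : nat).
Implicit Types p q : {mpoly R[D]}.

(** The degree is bounded in each variable separately, so that these polynomials form a space of
    dimension [(a + 1) ^ D] and dimension counts compare plain powers. *)
Definition boxdeg a p := forall m, p@_m != 0 -> forall i, (m i <= a)%N.

Lemma boxdegW a b p : (a <= b)%N -> boxdeg a p -> boxdeg b p.
Proof. by move=> ab pa m pm i; apply: leq_trans ab; apply: pa. Qed.

Lemma boxdegC a c : boxdeg a c%:MP.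
Proof.
move=> m; rewrite mcoeffC; have [->|_] := eqVneq m 0%MM.
  by move=> _ i; rewrite mnm0E.
by rewrite mulr0 eqxx.
Qed.

Lemma boxdegXm a (m : 'X_{1..D}) : (forall i, (m i <= a)%N) -> boxdeg a ('X_[m] : {mpoly R[D]}).
Proof. by move=> ma m'; rewrite mcoeffX; have [<-|] := eqVneq m m'; rewrite ?eqxx. Qed.

Lemma boxdegD a p q : boxdeg a p -> boxdeg a q -> boxdeg a (p + q).
Proof.
move=> pa qa m; rewrite mcoeffD.
have [->|/pa//] := eqVneq p@_m 0; have [->|/qa//] := eqVneq q@_m 0.
by rewrite addr0 eqxx.
Qed.

Lemma boxdeg_sum (J : finType) a (F : J -> {mpoly R[D]}) :
  (forall j, boxdeg a (F j)) -> boxdeg a (\sum_j F j).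
Proof.
move=> Fa; apply: big_ind => //; [exact: (@boxdegC a 0)|exact: boxdegD].
Qed.

Lemma mcoeffM_neq0 p q m : (p * q)@_m != 0 ->
  exists m1 m2, [/\ m = (m1 + m2)%MM, p@_m1 != 0 & q@_m2 != 0].
Proof.
rewrite -mcoeff_msupp => /msuppM_le /allpairsP[[m1 m2] /= [pm qm ->]].
by exists m1, m2; rewrite -!mcoeff_msupp.
Qed.

Lemma boxdegM a b p q : boxdeg a p -> boxdeg b q -> boxdeg (a + b) (p * q).
Proof.
move=> pa qb _ /mcoeffM_neq0[m1 [m2 [-> /pa pm /qb qm]]] i.
by rewrite mnmDE leq_add.
Qed.

Lemma boxdegX a p k : boxdeg a p -> boxdeg (k * a) (p ^+ k).
Proof.
move=> pa; elim: k => [|k IH]; first exact: boxdegC.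
by rewrite exprS mulSn; apply: boxdegM.
Qed.

Lemma boxdegZ a c p : boxdeg a p -> boxdeg a (c *: p).
Proof. by move=> pa; rewrite -mul_mpolyC; apply: (boxdegM (a := 0)) => //; apply: boxdegC. Qed.

(** Multiplicity at the origin, read off the coefficients. No derivative occurs, which makes it
    meaningful in every characteristic; zero has every order. *)
Definition vanish_order a p := forall m, p@_m != 0 -> (a <= mdeg m)%N.

Lemma vanish_order0 p : vanish_order 0 p. Proof. by []. Qed.

Lemma vanish_orderW a b p : (b <= a)%N -> vanish_order a p -> vanish_order b p.
Proof. by move=> ba pa m pm; apply: leq_trans (pa m pm). Qed.

Lemma vanish_orderD a p q :
  vanish_order a p -> vanish_order a q -> vanish_order a (p + q).
Proof.
move=> pa qa m; rewrite mcoeffD.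
have [->|/pa//] := eqVneq p@_m 0; have [->|/qa//] := eqVneq q@_m 0.
by rewrite addr0 eqxx.
Qed.

Lemma vanish_order_sum (J : Type) (r : seq J) a (F : J -> {mpoly R[D]}) :
  (forall j, vanish_order a (F j)) -> vanish_order a (\sum_(j <- r) F j).
Proof.
move=> Fa; apply: big_ind => //; last exact: vanish_orderD.
by move=> m; rewrite mcoeff0 eqxx.
Qed.

Lemma vanish_orderM a b p q :
  vanish_order a p -> vanish_order b q -> vanish_order (a + b) (p * q).
Proof.
move=> pa qb _ /mcoeffM_neq0[m1 [m2 [-> /pa pm /qb qm]]].
by rewrite mdegD leq_add.
Qed.

Lemma vanish_orderX a p k : vanish_order a p -> vanish_order (k * a) (p ^+ k).
Proof.
move=> pa; elim: k => [|k IH]; first exact: vanish_order0.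
by rewrite exprS mulSn; apply: vanish_orderM.
Qed.

Lemma vanish_order_prod (J : finType) (a : J -> nat) (F : J -> {mpoly R[D]}) :
  (forall j, vanish_order (a j) (F j)) ->
  vanish_order (\sum_j a j) (\prod_j F j).
Proof.
move=> Fa; apply: (big_ind2 (fun k p => vanish_order k p)) => //.
by move=> ? ? ? ?; apply: vanish_orderM.
Qed.

Lemma vanish_order1 p : p@_0%MM = 0 -> vanish_order 1 p.
Proof.
move=> p0 m; case: (eqVneq m 0%MM) => [->|]; first by rewrite p0 eqxx.
by rewrite -mdeg_eq0 lt0n.
Qed.

(** Translation of the point [v] to the origin: the multiplicity of [p] at [v] is the order of
    [shift v p]. *)
Definition shift (v : 'I_D -> R) p : {mpoly R[D]} :=
  mmap (@mpolyC D R) (fun i => 'X_i + (v i)%:MP) p.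

HB.instance Definition _ v := GRing.RMorphism.copy (shift v)
  (mmap (@mpolyC D R) (fun i => 'X_i + (v i)%:MP)).

Lemma shiftC v c : shift v c%:MP = c%:MP. Proof. exact: mmapC. Qed.

Lemma shiftX v i : shift v 'X_i = 'X_i + (v i)%:MP.
Proof. by rewrite /shift mmapX mmap1U. Qed.

Lemma shiftZ v c p : shift v (c *: p) = c *: shift v p.
Proof. by rewrite -!mul_mpolyC rmorphM /= shiftC. Qed.

Lemma mcoeff0_shift v p : (shift v p)@_0%MM = p.@[v].
Proof.
rewrite /shift /mmap mevalE raddf_sum /=; apply: eq_bigr => m _.
rewrite mul_mpolyC mcoeffZ; congr (_ * _).
rewrite /mmap1 (big_morph (mcoeff 0%MM) (id1 := 1) (op1 := *%R)).
- apply: eq_bigr => i _; rewrite rmorphXn /= mcoeffD mcoeffX mcoeffC eqxx mnm1_eq0.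
  by rewrite add0r mulr1.
- by move=> x y; rewrite rmorphM.
- by rewrite mcoeff1 eqxx.
Qed.

End BoxDegree.

(** * Interpolation *)

(** Greedy choice: while the chosen rows are too few, a nonzero column of their [cokermx] is a
    functional killing them all, and by hypothesis some element of [S] is not killed by it. *)
Lemma row_selection (K : fieldType) M (S : 'rV[K]_M -> Prop) :
  (forall c : 'cV[K]_M, (forall s, S s -> s *m c = 0) -> c = 0) ->
  exists2 A : 'M[K]_M, A \in unitmx & forall i, S (row i A).
Proof.
move=> Sfull.
suff H r : (r <= M)%N ->
    exists2 A : 'M[K]_(r, M), row_free A & forall i, S (row i A).
  by have [A Afree SA] := H M (leqnn M); exists A => //; rewrite -row_free_unit.
elim: r => [|r IH] rM.
  exists 0; first by rewrite /row_free mxrank0.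
  by case.
have [A Afree SA] := IH (ltnW rM).
have: cokermx A != 0.
  by rewrite -mxrank_eq0 mxrank_coker (eqP Afree) subn_eq0 -ltnNge.
case/matrix0Pn => i [j cij].
have [s Ss sc] : exists2 s, S s & s *m col j (cokermx A) != 0.
  apply: contrapT => noS; move: cij; suff /colP/(_ i) : col j (cokermx A) = 0.
    by rewrite !mxE => ->; rewrite eqxx.
  apply: Sfull => s Ss; apply/eqP; apply: contrapT => sc.
  by apply: noS; exists s => //; apply/negP.
rewrite -addn1; exists (col_mx A s).
  have sA : ~~ (s <= A)%MS.
    apply: contra sc => /submxP[u ->]; rewrite colE mulmxA -(mulmxA u).
    by rewrite mulmx_coker mulmx0 mul0mx.
  have : (A < col_mx A s)%MS.
    rewrite ltmxE; apply/andP; split; first by rewrite -addsmxE addsmxSl.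
    by rewrite -addsmxE addsmx_sub submx_refl.
  rewrite ltmxErank => /andP[_]; rewrite (eqP Afree) => ltr.
  by rewrite /row_free eqn_leq rank_leq_row; apply: leq_trans ltr; rewrite addn1.
move=> k; rewrite -(splitK k); case: split => a /=.
  by rewrite rowKu.
by rewrite rowKd row_id.
Qed.

Lemma leq_exp_sub t d D : (d <= t)%N ->
  (t ^ D <= (t - d) ^ D + D * d * t ^ D.-1)%N.
Proof.
move=> dt; elim: D => [|D IH]; first by rewrite !expn0 leq_addr.
rewrite expnS /=; apply: leq_trans (leq_mul (leqnn t) IH) _.
rewrite mulnDr -{1}(subnK dt) mulnDl -expnS -addnA leq_add2l.
have -> : (D.+1 * d * t ^ D = d * t ^ D + D * d * t ^ D)%N by lia.
apply: leq_add.
  rewrite leq_mul2l; apply/orP; right.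
  by case: (posnP D) => [->|D0]; rewrite ?expn0 // leq_exp2r // leq_subr.
by case: D {IH} => [|D]; rewrite ?muln0 // mulnCA -expnS.
Qed.

(** Put [t = e.+1 * m] and let [D > 0]. By [leq_exp_sub], [t ^ D - (t - d) ^ D] is at most
    [D * d * t ^ D.-1], while [(e.+1 * m') ^ D] is at least [(t / D) ^ D]; the last hypothesis makes
    the second bound the larger one. *)
Lemma box_count D m m' d e : (0 < m)%N -> (m <= D * m')%N || (D == 0)%N ->
  (D ^ D.+1 * d < e.+1 * m)%N ->
  ((e.+1 * m) ^ D < (e.+1 * m') ^ D + (e.+1 * m - d) ^ D)%N.
Proof.
case: D => [|D] m0; first by rewrite !expn0.
rewrite orbF => mm'; set t := (e.+1 * m)%N => dt.
have dt' : (d <= t)%N.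
  by apply: leq_trans (ltnW dt); rewrite leq_pmull // expn_gt0.
rewrite ltnNge; apply/negP => H.
have := leq_trans H (leq_exp_sub D.+1 dt'); rewrite addnC leq_add2l /= => {}H.
have H1 : (t ^ D.+1 <= D.+1 ^ D.+1 * (e.+1 * m') ^ D.+1)%N.
  by rewrite -expnMn leq_exp2r // mulnCA leq_mul2l mm' orbT.
have := leq_trans H1 (leq_mul (leqnn _) H).
rewrite !mulnA -expnSr (expnS t) leqNgt ltn_mul2r dt andbT expn_gt0.
by rewrite muln_gt0 m0.
Qed.

Section Multiplicity.
Variables (F : fieldType) (D : nat).
Implicit Types f g p : {mpoly F[D]}.

Definition box_mnm a (b : {ffun 'I_D -> 'I_a}) : 'X_{1..D} :=
  [multinom (b i : nat) | i < D].

Lemma box_mnm_inj a : injective (@box_mnm a).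
Proof.
move=> b c /mnmP bc; apply/ffunP => i; apply: val_inj.
by have := bc i; rewrite !mnmE.
Qed.

Lemma box_mnmP a (m : 'X_{1..D}) : (forall i, (m i < a)%N) -> exists b, m = @box_mnm a b.
Proof.
move=> ma; exists [ffun i => Ordinal (ma i)].
by apply/mnmP => i; rewrite mnmE ffunE.
Qed.

Lemma boxdeg_box_mnm a (b : {ffun 'I_D -> 'I_a.+1}) :
  boxdeg a ('X_[box_mnm b] : {mpoly F[D]}).
Proof. by apply: boxdegXm => i; rewrite mnmE -ltnS. Qed.

Lemma mcoeff_box_sum a (c : {ffun 'I_D -> 'I_a} -> F) b :
  (\sum_b' c b' *: 'X_[box_mnm b'])@_(box_mnm b) = c b.
Proof.
rewrite raddf_sum (bigD1 b) //= mcoeffZ mcoeffX eqxx mulr1.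
rewrite big1 ?addr0 // => b' b'b.
by rewrite mcoeffZ mcoeffX (inj_eq (@box_mnm_inj a)) (negPf b'b) mulr0.
Qed.

Lemma box_dependence (J : finType) a (v : J -> {mpoly F[D]}) :
  (forall j m, (v j)@_m != 0 -> forall i, (m i < a)%N) -> (a ^ D < #|J|)%N ->
  exists2 c : J -> F, (exists j, c j != 0) & \sum_j c j *: v j = 0.
Proof.
move=> va aJ.
have [|c c0 Hc] := @linear_dependence F J {ffun 'I_D -> 'I_a}
  (fun j b => (v j)@_(box_mnm b)); first by rewrite card_ffun !card_ord.
exists c => //; apply/mpolyP => m; rewrite raddf_sum mcoeff0 /=.
have [[b ->]|mNbox] := pselect (exists b, m = @box_mnm a b).
  by rewrite -[RHS](Hc b); apply: eq_bigr => j _; rewrite mcoeffZ.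
apply: big1 => j _; rewrite mcoeffZ; have [->|vm] := eqVneq (v j)@_m 0.
  by rewrite mulr0.
by case: mNbox; apply: box_mnmP; apply: va vm.
Qed.

(** By hypothesis the evaluations at points of [S] span the dual of the space of polynomials of box
    degree [e]. Choose a basis of the dual among them; the [L b] are the dual basis, read off an
    inverse matrix. *)
Lemma lagrange_basis (S : ('I_D -> F) -> Prop) e :
  (forall g, boxdeg e g -> (forall v, S v -> g.@[v] = 0) -> g = 0) ->
  exists (v : {ffun 'I_D -> 'I_e.+1} -> 'I_D -> F)
         (L : {ffun 'I_D -> 'I_e.+1} -> {mpoly F[D]}),
    [/\ forall b, S (v b), forall b, boxdeg e (L b) &
        forall b b', (L b).@[v b'] = (b == b')%:R].
Proof.
pose B := {ffun 'I_D -> 'I_e.+1}; move=> Sfull.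
pose ev (v : 'I_D -> F) : 'rV[F]_#|{: B}| :=
  \row_a ('X_[box_mnm (enum_val a : B)] : {mpoly F[D]}).@[v].
pose pl (c : 'cV[F]_#|{: B}|) : {mpoly F[D]} :=
  \sum_(b : B) c (enum_rank b) 0 *: 'X_[box_mnm b].
have evE v c : (ev v *m c) 0 0 = (pl c).@[v].
  rewrite mxE raddf_sum (reindex (@enum_val _ B)) /=; last first.
    by exists enum_rank => j _; rewrite ?enum_valK ?enum_rankK.
  by apply: eq_bigr => a _; rewrite mxE mevalZ enum_valK mulrC.
have plbox c : boxdeg e (pl c).
  by apply: boxdeg_sum => b; apply: boxdegZ; apply: boxdeg_box_mnm.
have [|A Aunit SA] := @row_selection F _ (fun s => exists2 v, S v & s = ev v).
  move=> c cS; apply/colP => a; rewrite mxE.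
  have : pl c = 0.
    by apply: Sfull => // v Sv; rewrite -evE cS ?mxE //; exists v.
  move=> /mpolyP/(_ (box_mnm (enum_val a))).
  by rewrite mcoeff_box_sum mcoeff0 enum_valK.
have /choice[v Hv] : forall b : B, exists v, S v /\ row (enum_rank b) A = ev v.
  by move=> b; have [v] := SA (enum_rank b); exists v.
exists v, (fun b => pl (col (enum_rank b) (invmx A))); split=> [b|b|b b'] //.
  by have [] := Hv b.
have [_ vb'] := Hv b'.
rewrite -evE -vb' -row_mul colE mulmxA mulmxV // mul1mx !mxE eqxx andbT.
by rewrite (inj_eq enum_rank_inj) eq_sym.
Qed.

End Multiplicity.

Lemma mcoeffMX0 (R : nzRingType) D (p : {mpoly R[D]}) (m : 'X_{1..D}) :
  (p * 'X_[m])@_m = p@_0%MM.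
Proof. by have := mcoeffMX p m 0; rewrite addm0. Qed.

Section LowDegree.
Variables (F : fieldType) (D : nat).
Implicit Types f g p : {mpoly F[D]}.

(* If no such [g] exists, there are Lagrange polynomials [L b] for
   [(e + 1) ^ D] points [v b] of [S]. The products
   [L b ^ m * (x - v b) ^ k] (with [k i < m'], where [D (m' - 1) < m]) are
   independent modulo the polynomials vanishing to order [m] on [S], hence
   modulo [f]; for degree reasons there are too many of them. *)
Lemma low_degree_of_multiplicity (S : ('I_D -> F) -> Prop) f d m e :
  f != 0 -> boxdeg d f -> (0 < m)%N ->
  (forall v, S v -> vanish_order m (shift v f)) ->
  (D ^ D.+1 * d < e.+1 * m)%N ->
  exists g, [/\ g != 0, boxdeg e g & forall v, S v -> g.@[v] = 0].
Proof.
move=> f0 fd m0 fS small; apply: contrapT => noG.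
have [|v [L [Sv Le Lv]]] := @lagrange_basis F D S e.
  move=> g ge gS; apply/eqP; apply: contrapT => /negP g0.
  by apply: noG; exists g.
(* For [D > 0] this is [m / D] rounded up: large enough for the count, and small enough that all
   exponents [k] have total degree below [m]. For [D = 0] division by zero gives [m' = 1]. *)
pose m' := (m.-1 %/ D).+1.
have m'D : (m <= D * m')%N || (D == 0)%N.
  case: (posnP D) => [->|D0]; first by rewrite orbT.
  by rewrite orbF -(ltn_predK m0) mulnC ltn_ceil.
have Dm' : (D * m'.-1 < m)%N.
  by rewrite /= -{2}(ltn_predK m0) ltnS mulnC leq_trunc_div.
have m'm : (m' <= m)%N by rewrite -(ltn_predK m0) ltnS leq_div.
set t := (e.+1 * m)%N in small.
have count := box_count m0 m'D small.
pose B := {ffun 'I_D -> 'I_e.+1}; pose B' := {ffun 'I_D -> 'I_m'}.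
pose B'' := {ffun 'I_D -> 'I_(t - d)}.
pose pw (b : B) (k : 'X_{1..D}) : {mpoly F[D]} :=
  \prod_i ('X_i - (v b i)%:MP) ^+ k i.
pose w (j : (B * B') + B'') : {mpoly F[D]} :=
  match j with
  | inl bk => L bk.1 ^+ m * pw bk.1 (box_mnm bk.2)
  | inr k => f * 'X_[box_mnm k]
  end.
have pwbox b (k : B') : boxdeg m'.-1 (pw b (box_mnm k)).
  have multM (u1 u2 : 'X_{1..D}) p1 p2 :
      (forall l, p1@_l != 0 -> (l <= u1)%MM) ->
      (forall l, p2@_l != 0 -> (l <= u2)%MM) ->
      forall l, (p1 * p2)@_l != 0 -> (l <= u1 + u2)%MM.
    move=> H1 H2 _ /mcoeffM_neq0[l1 [l2 [-> /H1 /mnm_lepP h1 /H2 /mnm_lepP h2]]].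
    by apply/mnm_lepP => i; rewrite !mnmDE leq_add.
  have mult1 l : (1 : {mpoly F[D]})@_l != 0 -> (l <= 0)%MM.
    by rewrite mcoeff1; have [->|] := eqVneq l 0%MM; rewrite ?lepm_refl ?eqxx.
  suff H : forall l, (pw b (box_mnm k))@_l != 0 -> (l <= box_mnm k)%MM.
    move=> l /H /mnm_lepP lk i; apply: leq_trans (lk i) _.
    by rewrite mnmE -ltnS.
  rewrite {2}[box_mnm k]multinomUE_id.
  apply: (big_ind2 (fun u p => forall l, p@_l != 0 -> (l <= u)%MM)).
  - exact: mult1.
  - by move=> u1 p1 u2 p2; apply: multM.
  move=> i _; elim: (box_mnm k i) => [|a IH]; first by rewrite mulm0n.
  rewrite exprS mulmS; apply: multM => // l.
  rewrite mcoeffB mcoeffX mcoeffC; have [<- _|_] := eqVneq _ l; first exact: lepm_refl.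
  have [-> _|_] := eqVneq l 0%MM; last by rewrite mulr0 subr0 eqxx.
  by apply/mnm_lepP => j; rewrite mnm0E.
have [||c [j0 cj0] c0] := @box_dependence F D _ t w.
- case=> [[b k] | k] mm /=.
    have : boxdeg (m * e + m'.-1) (L b ^+ m * pw b (box_mnm k)).
      by apply: boxdegM => //; apply: boxdegX.
    move=> /[apply] H i; apply: leq_ltn_trans (H i) _; rewrite /t; lia.
  case/mcoeffM_neq0 => m1 [m2 [-> /fd m1d]].
  rewrite mcoeffX /=; have [<-|] := eqVneq (box_mnm k) m2; last by rewrite eqxx.
  move=> _ i; rewrite mnmDE mnmE.
  by rewrite (leq_ltn_trans (leq_add (m1d i) (leqnn _))) // -ltn_subRL ltn_ord.
- rewrite [#|_|]card_sum [#|{: B * B'}|]card_prod !card_ffun !card_ord.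
  by rewrite -expnMn.
have shpw b (k : B') : shift (v b) (pw b (box_mnm k)) = 'X_[box_mnm k].
  rewrite /pw rmorph_prod /= mpolyXE_id; apply: eq_bigr => i _.
  by rewrite rmorphXn /= rmorphB /= shiftX shiftC addrK.
(* Induction on the degree of [k]. Translate [v b] to the origin and read the coefficient of
   [x ^ k], of degree less than [m]. Multiples of [f] and terms with [b' <> b] vanish to order [m];
   terms with smaller [k'] are zero by induction, and other [k'] do not reach [x ^ k]. What remains
   is [c (inl (b, k))], as [L b] is 1 at [v b]. *)
have cl b k : c (inl (b, k)) = 0.
  apply/eqP; apply: contrapT; move/negP.
  have [n] := ubnP (mdeg (box_mnm k)).
  elim: n k => // n IH k; rewrite ltnS => kn ck.
  have IH' k' : (mdeg (box_mnm k') < mdeg (box_mnm k))%N -> c (inl (b, k')) = 0.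
    move=> lt; apply/eqP; apply: contrapT => /negP ck'.
    by apply: (IH k') => //; apply: leq_trans lt kn.
  have mk : (mdeg (box_mnm k) < m)%N.
    apply: leq_ltn_trans Dm'; rewrite mdegE -[X in (_ <= X * _)%N]card_ord -sum_nat_const.
    by apply: leq_sum => i _; rewrite mnmE -ltnS.
  have /(congr1 (fun p => (shift (v b) p)@_(box_mnm k))) := c0.
  rewrite rmorph_sum rmorph0 raddf_sum mcoeff0 (bigD1 (inl (b, k))) //=.
  rewrite shiftZ mcoeffZ rmorphM rmorphXn /= shpw.
  rewrite mcoeffMX0 rmorphXn /= mcoeff0_shift Lv eqxx expr1n mulr1.
  rewrite big1 ?addr0; first by move/eqP; rewrite (negPf ck).
  move=> j jbk; rewrite shiftZ mcoeffZ.
  have vo p : vanish_order m p -> p@_(box_mnm k) = 0.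
    move=> pm; apply/eqP; apply: contrapT => /negP/pm.
    by rewrite leqNgt mk.
  case: j jbk => [[b' k']|k'] /= jbk; last first.
    rewrite vo ?mulr0 // rmorphM /=.
    apply: (@vanish_orderW _ _ (m + 0)); first by rewrite addn0.
    by apply: vanish_orderM => //; apply: fS.
  have [bb'|bb'] := eqVneq b b'; last first.
    rewrite vo ?mulr0 // rmorphM /= rmorphXn /=.
    apply: (@vanish_orderW _ _ (m * 1 + 0)); first by rewrite muln1 addn0.
    apply: vanish_orderM => //; apply: vanish_orderX.
    by apply: vanish_order1; rewrite mcoeff0_shift Lv eq_sym (negPf bb').
  subst b'; rewrite rmorphM /= shpw.
  have [lt|ge] := ltnP (mdeg (box_mnm k')) (mdeg (box_mnm k)).
    by rewrite IH' ?mul0r.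
  apply/eqP; rewrite mulf_eq0; apply/orP; right; apply/negPn/negP.
  case/mcoeffM_neq0 => m1 [m2 [km _]].
  rewrite mcoeffX /=; have [m2E _|] := eqVneq (box_mnm k') m2; last by rewrite eqxx.
  move: ge; rewrite km m2E mdegD -{2}[mdeg m2]add0n leq_add2r leqn0 mdeg_eq0.
  move=> /eqP m10; move: km; rewrite m10 add0m -m2E => /box_mnm_inj kk'.
  by rewrite kk' eqxx in jbk.
have cr : \sum_k c (inr k) *: 'X_[box_mnm k] = 0 :> {mpoly F[D]}.
  apply/eqP; have /eqP : f * \sum_k c (inr k) *: 'X_[box_mnm k] = 0.
    rewrite -[RHS]c0 big_sumType /= [X in _ = X + _]big1; last first.
      by case=> b k _; rewrite cl scale0r.
    by rewrite add0r mulr_sumr; apply: eq_bigr => k _; rewrite scalerAr.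
  by rewrite mulf_eq0 (negPf f0).
case: j0 cj0 => [[b k]|k]; first by rewrite cl eqxx.
by rewrite -(mcoeff_box_sum (fun k => c (inr k))) cr mcoeff0 eqxx.
Qed.

End LowDegree.

(** * Pluecker coordinates and charts *)

(** Constant row operations bring the value [M0] of [M] at the origin to a form whose rows from the
    [r]-th on are zero. Each term of the determinant then has [s - r] factors vanishing at the
    origin. *)
Lemma det_vanish_order (F : fieldType) D s (M : 'M[{mpoly F[D]}]_s) :
  vanish_order (s - \rank (map_mx (mcoeff 0%MM) M)) (\det M).
Proof.
set M0 := map_mx _ M; set r := \rank M0.
pose C := invmx (col_ebase M0).
have Cu : C \in unitmx by rewrite unitmx_inv col_ebase_unit.
have CM0 : C *m M0 = pid_mx r *m row_ebase M0.
  by rewrite -[X in _ *m X = _]mulmx_ebase !mulmxA mulVmx ?col_ebase_unit // mul1mx.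
pose M' := map_mx (@mpolyC D F) C *m M.
have detM : \det M = (\det (invmx C))%:MP * \det M'.
  rewrite det_mulmx det_map_mx /= mulrA -mpolyCM -det_mulmx mulVmx // det1.
  by rewrite mpolyC1 mul1r.
rewrite detM; apply: (@vanish_orderW _ _ (0 + (s - r))) => //.
apply: vanish_orderM; first exact: vanish_order0.
apply: vanish_order_sum => sg.
apply: (@vanish_orderW _ _ (0 + \sum_(i < s) (r <= i))%N).
  rewrite add0n.
  elim: (s) => [|t IH]; first by rewrite sub0n.
  rewrite big_ord_recr /=; case: (leqP r t) => [rt|tr].
    by rewrite addn1 subSn.
  by have /eqP -> : (t.+1 - r == 0)%N by rewrite subn_eq0.
apply: vanish_orderM; first exact: vanish_order0.
apply: vanish_order_prod => i.
case: leqP => // ri; apply: vanish_order1.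
have : (C *m M0) i (sg i) = 0.
  rewrite CM0 mxE big1 // => j _; rewrite mxE ltnNge ri andbF mul0r //.
move=> CM0i; rewrite mxE raddf_sum -[RHS]CM0i mxE; apply: eq_bigr => j _.
by rewrite mxE [M0 _ _]mxE /= mcoeffCM.
Qed.

Section PluckerForms.
Variables (F : fieldType) (n k : nat).

Lemma increasing_enum (A : {set 'I_n}) (cA : #|A| = k) :
  exists2 g : {ffun 'I_k -> 'I_n},
    (forall i j : 'I_k, (i < j)%N -> (g i < g j)%N) &
    forall x, x \in A -> exists i, g i = x.
Proof.
subst k; exists [ffun i => enum_val i] => [i j ij|x xA].
  have x0 : 'I_n := enum_val i; rewrite !ffunE !(enum_val_nth x0).
  have sA : sorted ltn (map val (enum A)).
    rewrite (sorted_map) /=.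
    have -> : enum A = filter (mem A) (enum 'I_n) by rewrite enumT.
    apply: sorted_filter; first by move=> ? ? ?; apply: ltn_trans.
    by rewrite -sorted_map val_enum_ord iota_ltn_sorted.
  have := sorted_ltn_nth ltn_trans 0%N sA; move/(_ i j).
  rewrite !inE size_map -cardE !ltn_ord => /(_ isT isT ij).
  by rewrite !(nth_map x0) -?cardE.
by exists (enum_rank_in xA x); rewrite ffunE enum_rankK_in.
Qed.

(** Sorting [f] costs a sign, and a repeated column gives 0. The form [q] is independent of the
    ring, so that it can be evaluated both at planes over [F] and at matrices of polynomials. *)
Lemma plucker_form (f : 'I_k -> 'I_n) :
  exists2 q : {mpoly F[#|{: plucker_index n k}|]}, q \is 1.-homog &
    forall (R : comNzRingType) (h : {rmorphism F -> R}) (B : 'M[R]_(k, n)),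
      mmap h (plucker B) q = \det (colsub f B).
Proof.
have [finj|fNinj] := boolP (injectiveb f); last first.
  exists 0; first exact: dhomog0.
  move=> R h B; rewrite mmap0 -det_tr.
  have [i [j ij fij]] := injectivePn _ fNinj.
  by rewrite (determinant_alternate ij) // => l; rewrite !mxE fij.
have /injectiveP {}finj := finj.
have [|g gincr gsurj] := @increasing_enum [set f i | i in setT].
  by rewrite card_imset // cardsT card_ord.
have /choice[s sE] : forall i, exists i', g i' = f i.
  by move=> i; apply: gsurj; apply: imset_f.
have sinj : injective s by move=> i j sij; apply: finj; rewrite -!sE sij.
have gP : [forall i : 'I_k, forall j : 'I_k, (i < j)%N ==> (g i < g j)%N].
  by apply/forallP => i; apply/forallP => j; apply/implyP; apply: gincr.
pose J : plucker_index n k := exist _ g gP.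
exists ((-1) ^+ perm sinj *: 'X_(enum_rank J)).
  by rewrite dhomogZ // dhomogX; apply/eqP; apply: mdeg1.
move=> R h B; rewrite mmapZ mmapX mmap1U rmorph_sign /plucker enum_rankK /=.
have -> : colsub f B = col_perm (perm sinj) (colsub g B).
  by apply/matrixP => i j; rewrite !mxE permE sE.
by rewrite col_permE det_mulmx det_perm odd_permV mulrC.
Qed.

End PluckerForms.

Section Chart.
Variables (n k : nat) (hkn : (k <= n)%N) (s : 'S_n).

Definition col_id (a : 'I_(n - k)) : 'I_n :=
  (s^-1)%g (cast_ord (subnK hkn) (lshift k a)).
Definition col_var (b : 'I_k) : 'I_n :=
  (s^-1)%g (cast_ord (subnK hkn) (rshift (n - k) b)).

Lemma split_col_id a :
  split (cast_ord (esym (subnK hkn)) (s (col_id a))) = inl a.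
Proof. by rewrite permKV cast_ordK -[lshift _ _]/(unsplit (inl a)) unsplitK. Qed.

Lemma split_col_var b :
  split (cast_ord (esym (subnK hkn)) (s (col_var b))) = inr b.
Proof. by rewrite permKV cast_ordK -[rshift _ _]/(unsplit (inr b)) unsplitK. Qed.

Lemma taut_col_id (F : fieldType) i a :
  taut_mx F hkn s i (col_id a) = (i == a)%:R.
Proof. by rewrite mxE split_col_id. Qed.

Lemma taut_col_var (F : fieldType) i b :
  taut_mx F hkn s i (col_var b) = 'X_(mxvec_index i b).
Proof. by rewrite mxE split_col_var. Qed.

Variant chart_col_spec : 'I_n -> Type :=
  | ChartId a : chart_col_spec (col_id a)
  | ChartVar b : chart_col_spec (col_var b).

Lemma chart_colP j : chart_col_spec j.
Proof.
have jE : j = (s^-1)%g (cast_ord (subnK hkn)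
    (cast_ord (esym (subnK hkn)) (s j))) by rewrite cast_ordKV permK.
rewrite jE -(splitK (cast_ord (esym (subnK hkn)) (s j))).
by case: split => a; constructor.
Qed.

Lemma sum_chart (V : nmodType) (f : 'I_n -> V) :
  \sum_j f j = \sum_a f (col_id a) + \sum_b f (col_var b).
Proof.
rewrite (reindex (fun i => (s^-1)%g (cast_ord (subnK hkn) i))) /=.
  exact: big_split_ord.
exists (fun j => cast_ord (esym (subnK hkn)) (s j)) => j _.
  by rewrite permKV cast_ordK.
by rewrite cast_ordKV permK.
Qed.

Definition col_swap a b (b' : 'I_k) : 'I_n :=
  if b' == b then col_id a else col_var b'.

(** Cramer's rule: up to the common factor given by the [col_var] minor, the chart coordinates are
    themselves maximal minors. *)
Lemma adj_colsub (R : comNzRingType) (B : 'M[R]_(k, n)) a b :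
  (\adj (colsub col_var B) *m B) b (col_id a) = \det (colsub (col_swap a b) B).
Proof.
rewrite (expand_det_col _ b) mxE; apply: eq_bigr => c _.
rewrite !mxE mulrC /col_swap eqxx; congr (_ * ((-1) ^+ _ * \det _)).
by apply/matrixP => i j; rewrite !mxE eq_sym (negPf (neq_lift _ _)).
Qed.

(** A basis of the kernel of the forms with matrix [(1 | Y)]: the transpose of [- Y] next to an
    identity block, with permuted columns. *)
Definition chart_mx (R : comNzRingType) (Y : 'M[R]_(n - k, k)) : 'M[R]_(k, n) :=
  \matrix_(b, j) match split (cast_ord (esym (subnK hkn)) (s j)) with
    | inl a => - Y a b
    | inr b' => (b == b')%:R
    end.

Lemma chart_mx_var (R : comNzRingType) (Y : 'M[R]_(n - k, k)) :
  colsub col_var (chart_mx Y) = 1%:M.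
Proof. by apply/matrixP => i j; rewrite !mxE split_col_var. Qed.

(** Normalizing the [col_var] block of [w] to the identity gives a matrix of the shape [chart_mx],
    from which [Y] is read off. This is meaningful only if that block is invertible. *)
Definition chart_coord (F : fieldType) (w : 'M[F]_(k, n)) :
    'I_((n - k) * k) -> F :=
  mxvec (\matrix_(a, b) - (invmx (colsub col_var w) *m w) b (col_id a)) 0.

Lemma taut_chart_coord (F : fieldType) (w : 'M[F]_(k, n)) :
  colsub col_var w \in unitmx ->
  w *m (map_mx (meval (chart_coord w)) (taut_mx F hkn s))^T = 0.
Proof.
move=> wu; rewrite -[X in X *m _ = _](mulKVmx wu) -mulmxA.
set w' := invmx _ *m w; suff -> : w' *m (map_mx (meval (chart_coord w))
  (taut_mx F hkn s))^T = 0 by rewrite mulmx0.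
apply/matrixP => b i; rewrite mxE [RHS]mxE sum_chart.
have w'var c : w' b (col_var c) = (b == c)%:R.
  have /matrixP/(_ b c) : colsub col_var w' = 1%:M.
    by rewrite /w' -mulmx_colsub mulVmx.
  by rewrite !mxE.
have tE j : (map_mx (meval (chart_coord w)) (taut_mx F hkn s))^T j i =
    (taut_mx F hkn s i j).@[chart_coord w] by rewrite mxE [LHS]mxE.
rewrite (bigD1 i) //= [X in _ + X + _]big1 => [|a ai]; last first.
  rewrite tE taut_col_id eq_sym (negPf ai).
  by rewrite raddf0 mulr0.
rewrite tE taut_col_id eqxx rmorph1 mulr1 addr0.
rewrite (bigD1 b) //= big1 => [|c cb]; last by rewrite w'var eq_sym (negPf cb) mul0r.
rewrite w'var eqxx mul1r addr0 tE taut_col_var mevalXU.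
by rewrite /chart_coord mxvecE mxE subrr.
Qed.

Lemma sum_homogenize (F : fieldType) (R : comNzRingType) (h : {rmorphism F -> R}) D
    (g : {mpoly F[D]}) e p0 (y u : 'I_D -> R) :
  (forall m, g@_m != 0 -> (mdeg m <= e)%N) -> (forall l, u l = p0 * y l) ->
  \sum_(m <- msupp g) h g@_m * (p0 ^+ (e - mdeg m) * mmap1 u m)
    = p0 ^+ e * mmap h y g.
Proof.
move=> ge uE; rewrite /mmap mulr_sumr big_seq [RHS]big_seq.
apply: eq_bigr => m; rewrite mcoeff_msupp => /ge me.
have -> : mmap1 u m = p0 ^+ mdeg m * mmap1 y m.
  rewrite mdegE -prodrXr -big_split /=; apply: eq_bigr => i _.
  by rewrite uE exprMn.
by rewrite !mulrA -(mulrA (h _)) -exprD subnK // (mulrC (h _)).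
Qed.

(** In [g], each coordinate is replaced by a quotient of Pluecker forms with denominator [q0], and
    [q0 ^ e] clears the denominators. One further factor [q0] makes [G] vanish outside the chart,
    whence the degree [e.+1]. *)
Lemma chart_hypersurface (F : fieldType) (g : {mpoly F[(n - k) * k]}) e :
  g != 0 -> (forall m, g@_m != 0 -> (mdeg m <= e)%N) ->
  exists2 G : {mpoly F[#|{: plucker_index n k}|]}, Gr_hypersurface e.+1 G &
    forall w : 'M[F]_(k, n),
      (colsub col_var w \in unitmx -> g.@[chart_coord w] = 0) ->
      G.@[plucker w] = 0.
Proof.
move=> g0 ge.
have [q0 q0h q0E] := @plucker_form F n k col_var.
have /choice[q qP] : forall ab : 'I_(n - k) * 'I_k,
    exists q : {mpoly F[#|{: plucker_index n k}|]}, q \is 1.-homog /\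
    forall (R : comNzRingType) (h : {rmorphism F -> R}) (B : 'M[R]_(k, n)),
      mmap h (plucker B) q = \det (colsub (col_swap ab.1 ab.2) B).
  by move=> ab; have [q qh qE] := @plucker_form F n k (col_swap ab.1 ab.2); exists q.
pose Q l := mxvec (\matrix_(a, b) - q (a, b)) 0 l.
pose G := q0 * \sum_(m <- msupp g)
  (g@_m)%:MP * (q0 ^+ (e - mdeg m) * mmap1 Q m).
have Qh l : Q l \is 1.-homog.
  by case/mxvec_indexP: l => a b; rewrite /Q mxvecE mxE rpredN; have [] := qP (a, b).
have GE (R : comNzRingType) (h : {rmorphism F -> R}) (B : 'M[R]_(k, n)) y :
    (forall a b, \det (colsub (col_swap a b) B) =
      \det (colsub col_var B) * - y (mxvec_index a b)) ->
    mmap h (plucker B) G = \det (colsub col_var B) ^+ e.+1 * mmap h y g.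
  move=> yE; rewrite /G rmorphM /= q0E exprS -mulrA; congr (_ * _).
  rewrite -(@sum_homogenize _ _ h _ g e _ y (fun l => mmap h (plucker B) (Q l))) //.
    rewrite rmorph_sum; apply: eq_bigr => m _.
    rewrite !rmorphM /= mmapC rmorphXn /= q0E; congr (_ * (_ * _)).
    by rewrite rmorph_prod; apply: eq_bigr => i _; rewrite rmorphXn.
  move=> l; case/mxvec_indexP: l => a b; rewrite /Q mxvecE mxE rmorphN.
  by have [_ /= ->] := qP (a, b); rewrite yE mulrN opprK.
exists G; last first.
  move=> w gw; have [wu|wNu] := boolP (colsub col_var w \in unitmx).
    rewrite [LHS](GE F idfun w (chart_coord w)) ?[mmap _ _ _]gw ?mulr0 // => a b.
    rewrite -adj_colsub /chart_coord mxvecE mxE opprK /invmx wu.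
    by rewrite -scalemxAl [X in _ = _ * X]mxE mulrA mulrV ?mul1r -?unitmxE.
  rewrite /G mevalM [X in X * _](q0E F idfun).
  by move: wNu; rewrite unitmxE unitfE negbK => /eqP ->; rewrite mul0r.
split.
  rewrite -add1n /G; apply: dhomogM => //; rewrite big_seq; apply: rpred_sum => m.
  rewrite mcoeff_msupp mul_mpolyC => /ge me; apply: dhomogZ.
  rewrite -{2}(subnK me); apply: dhomogM.
    by rewrite -{2}[(e - _)%N]mul1n; apply: dhomogMn.
  rewrite /mmap1 mdegE.
  apply: (big_ind2 (fun p d => p \is d.-homog)); first exact: dhomog1.
    by move=> ? ? ? ?; apply: dhomogM.
  by move=> i _; rewrite -{2}[m i]mul1n; apply: dhomogMn.
(* [G] is nonzero on the Grassmannian because substituting [chart_mx Y] for the generic matrix gives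
   back [g]: the [col_var] minor of [chart_mx Y] is 1. *)
pose D := ((n - k) * k)%N.
pose Y : 'M[{mpoly F[D]}]_(n - k, k) := \matrix_(a, b) 'X_(mxvec_index a b).
pose rho l := mxvec (chart_mx Y) 0 l.
move=> G0; have /(congr1 (mmap (@mpolyC D F) rho)) := G0.
rewrite mmap0.
have -> : mmap (@mpolyC D F) rho (mmap (@mpolyC (k * n) F)
    (plucker (generic_mx n k F)) G) = mmap (@mpolyC D F) (plucker (chart_mx Y)) G.
  rewrite [X in mmap _ _ X = _]/mmap rmorph_sum [RHS]/mmap; apply: eq_bigr => m _.
  rewrite rmorphM /= mmapC rmorph_prod /=; congr (_ * _).
  apply: eq_bigr => i _; rewrite rmorphXn /= /plucker -det_map_mx.
  set M1 := map_mx _ _; set M2 := colsub _ _.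
  suff -> : M1 = M2 by [].
  apply/matrixP => b j.
  rewrite [LHS]mxE /= [X in mmap _ _ X]mxE [X in mmap _ _ X]mxE mmapX mmap1U.
  by rewrite /rho mxvecE [RHS]mxE.
rewrite (GE _ (@mpolyC D F) (chart_mx Y) (fun l => 'X_l)).
  rewrite chart_mx_var det1 expr1n mul1r => gg.
  suff E : mmap (@mpolyC D F) (fun l => 'X_l) g = g by rewrite -E gg eqxx in g0.
  rewrite {2}[g]mpolyE /mmap; apply: eq_bigr => m _.
  by rewrite mul_mpolyC mmap1_id.
move=> a b; rewrite -adj_colsub chart_mx_var det1 mul1r adj1 mul1mx mxE.
by rewrite split_col_id mxE.
Qed.

End Chart.

(** * Rank of the multiplication map at rich directions *)

Section Quotient.
Variables (F : fieldType) (n : nat) (I : {mpoly F[n]} -> Prop).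
Hypothesis idealI : is_ideal I.

Lemma ideal0 : I 0. Proof. by case: idealI. Qed.
Lemma idealD p q : I p -> I q -> I (p + q). Proof. by case: idealI => _ + _; apply. Qed.
Lemma idealMl p q : I q -> I (p * q). Proof. by case: idealI => _ _; apply. Qed.
Lemma idealMr p q : I p -> I (p * q). Proof. by rewrite mulrC; apply: idealMl. Qed.
Lemma ideal_sum (J : Type) (r : seq J) (P : pred J) f :
  (forall j, P j -> I (f j)) -> I (\sum_(j <- r | P j) f j).
Proof. by move=> If; apply: big_ind => //; [exact: ideal0|exact: idealD]. Qed.

Lemma nilpotentD p q a b : I (p ^+ a) -> I (q ^+ b) -> I ((p + q) ^+ (a + b)).
Proof.
move=> Ip Iq; rewrite exprDn; apply: ideal_sum => i _; rewrite -mulr_natl.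
apply: idealMl; case: (leqP b i) => bi.
  by apply: idealMl; rewrite -(subnK bi) exprD; apply: idealMl.
apply: idealMr; have ai : (a <= a + b - i)%N by lia.
by rewrite -(subnK ai) exprD; apply: idealMl.
Qed.

Lemma nilpotent_linear (c : 'I_n -> F) : supported_at_origin I ->
  exists e, I ((\sum_j c j *: 'X_j) ^+ e).
Proof.
move=> suppI; apply: (big_ind (fun p => exists e, I (p ^+ e))) => [|p q [a Ip] [b Iq]|j _].
- by exists 1%N; rewrite expr1; apply: ideal0.
- by exists (a + b)%N; apply: nilpotentD.
- have [e Ie] := suppI j; exists e.
  by rewrite exprZn -mul_mpolyC; apply: idealMl.
Qed.

Lemma ideal_add_is_ideal r (l : 'I_r -> {mpoly F[n]}) : is_ideal (ideal_add I l).
Proof.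
split.
- exists 0, (fun=> 0); split; first exact: ideal0.
  by rewrite add0r big1 // => i _; rewrite mul0r.
- move=> _ _ [a [q [Ia ->]]] [a' [q' [Ia' ->]]].
  exists (a + a'), (fun i => q i + q' i); split; first exact: idealD.
  by rewrite addrACA -big_split; congr (_ + _); apply: eq_bigr => i _; rewrite mulrDl.
- move=> p _ [a [q [Ia ->]]].
  exists (p * a), (fun i => p * q i); split; first exact: idealMl.
  by rewrite mulrDr mulr_sumr; congr (_ + _); apply: eq_bigr => i _; rewrite mulrA.
Qed.

Lemma ideal_addl r (l : 'I_r -> {mpoly F[n]}) p : I p -> ideal_add I l p.
Proof.
move=> Ip; exists p, (fun=> 0); split => //.
by rewrite big1 ?addr0 // => i _; rewrite mul0r.
Qed.

Lemma ideal_addr r (l : 'I_r -> {mpoly F[n]}) i : ideal_add I l (l i).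
Proof.
exists 0, (fun j => (j == i)%:R); split; first exact: ideal0.
rewrite add0r (bigD1 i) //= eqxx mul1r big1 ?addr0 // => j ji.
by rewrite (negPf ji) mul0r.
Qed.

Variables (N : nat) (A : quot_basis I N).

Lemma quot_expand p : I (p - \sum_a qcoord A p 0 a *: qbasis A a).
Proof.
apply/(qcoord_ker A); rewrite linearB raddf_sum /=; apply/eqP.
rewrite subr_eq0; apply/eqP; rewrite [LHS]row_sum_delta; apply: eq_bigr => a _.
by rewrite linearZ /= qcoord_basis.
Qed.

Lemma qcoord_expand (V : lmodType F) (f : {linear {mpoly F[n]} -> V}) p :
  (forall q, I q -> f q = 0) ->
  f p = \sum_a qcoord A p 0 a *: f (qbasis A a).
Proof.
move=> /(_ _ (quot_expand p))/eqP; rewrite linearB subr_eq0 => /eqP ->.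
by rewrite raddf_sum; apply: eq_bigr => a _; rewrite /= linearZ.
Qed.

Definition mulX_mx (j : 'I_n) : 'M[F]_N :=
  \matrix_(a, b) qcoord A ('X_j * qbasis A a) 0 b.

Lemma qcoord_mulX j p : qcoord A ('X_j * p) = qcoord A p *m mulX_mx j.
Proof.
have /(qcoord_ker A) := idealMl 'X_j (quot_expand p).
rewrite mulrBr linearB /= => /eqP; rewrite subr_eq0 => /eqP ->.
rewrite mulr_sumr raddf_sum mulmx_sum_row; apply: eq_bigr => a _.
rewrite -scalerAr /= linearZ /=; congr (_ *: _).
by apply/rowP => b; rewrite !mxE.
Qed.

Lemma mulX_mxC i j : mulX_mx i *m mulX_mx j = mulX_mx j *m mulX_mx i.
Proof.
suff H a : row a (mulX_mx i *m mulX_mx j) = row a (mulX_mx j *m mulX_mx i).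
  by apply/row_matrixP.
have E l l' : row a (mulX_mx l *m mulX_mx l') = qcoord A ('X_l' * ('X_l * qbasis A a)).
  by rewrite !qcoord_mulX qcoord_basis -mulmxA -rowE.
by rewrite !E mulrCA.
Qed.

(** [T] is the matrix of the projection from [A] onto the coordinate ring of the intersection with
    the plane. It is surjective, hence of rank [d], and it kills all multiples of the linear forms
    that vanish on [w]. *)
Lemma rich_plane_rank m k (hkn : (k <= n)%N) (w : 'M[F]_(k, n))
    (M : 'M[F]_(n - k, n)) :
  (0 < m)%N -> supported_at_origin I -> Sigma I m w -> w *m M^T = 0 ->
  exists2 d, (m <= d)%N & exists2 T : 'M[F]_(N, d), \rank T = d &
    forall i a, qcoord A ((\sum_j M i j *: 'X_j) * qbasis A a) *m T = 0.
Proof.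
move=> m0 suppI [_ [L [c [_ wL [d [[B] md]]]]]] wM.
set J := ideal_add _ _ in B.
have idJ : is_ideal J by apply: ideal_add_is_ideal.
exists d => //.
have IJ p : I p -> qcoord B p = 0 by move=> Ip; apply/(qcoord_ker B); apply: ideal_addl.
pose T : 'M[F]_(N, d) := \matrix_a qcoord B (qbasis A a).
have BE p : qcoord B p = qcoord A p *m T.
  rewrite [LHS](qcoord_expand _ IJ) mulmx_sum_row.
  by apply: eq_bigr => a _; rewrite rowK.
exists T.
  apply/eqP; rewrite eqn_leq rank_leq_col /=.
  apply: (@leq_trans (\rank (1%:M : 'M[F]_d))); first by rewrite mxrank1.
  apply: mxrankS; apply/row_subP => a.
  by rewrite row1 -(qcoord_basis B) BE submxMl.
have J1 : ~ J 1.
  move=> J1; pose a := Ordinal (leq_trans m0 md).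
  have /(qcoord_ker B) : J (qbasis B a).
    by case: idJ => _ _ /(_ (qbasis B a) 1 J1); rewrite mulr1.
  rewrite qcoord_basis => /rowP/(_ a); rewrite !mxE !eqxx => /eqP.
  by rewrite oner_eq0.
(* The linear part of the equation is nilpotent modulo the ideal. With a nonzero constant term the
   equation would be invertible and the intersection empty, so the plane passes through the
   origin. *)
have c0 i : c i 0 = 0.
  apply/eqP; apply: contrapT => /negP ci; apply: J1.
  have [e Ie] := nilpotent_linear (L i) suppI.
  set p := \sum_j _ in Ie; have [J0 JD JM] := idJ.
  have Jp : J (p - (- c i 0)%:MP).
    by rewrite mpolyCN opprK; apply: (ideal_addr (plane_eqn L c)).
  have JB q1 q2 : J q1 -> J (q1 - q2) -> J q2.
    move=> Jq1 /(JM (-1)); rewrite mulN1r opprB => /JD/(_ Jq1).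
    by rewrite subrK.
  have : J ((- c i 0)%:MP ^+ e).
    apply: (JB (p ^+ e)); first exact: ideal_addl.
    by rewrite subrXX mulrC; apply: JM.
  move/(JM ((- c i 0) ^- e)%:MP); rewrite -rmorphXn -rmorphM /= mulVf ?mpolyC1 //.
  by rewrite expf_neq0 // oppr_eq0.
have /submxP[U ME] : (M <= L)%MS.
  have LwC : ((cokermx L)^T <= w)%MS.
    rewrite (eqmxP wL); apply/sub_kermxP.
    by rewrite -trmx_mul mulmx_coker trmx0.
  rewrite submxE -trmx_eq0 trmx_mul.
  by case/submxP: LwC => V ->; rewrite -mulmxA wM mulmx0.
move=> i a; rewrite -BE; apply/(qcoord_ker B); have [J0 JD JM] := idJ.
rewrite mulrC; apply: (JM).
have -> : \sum_j M i j *: 'X_j = \sum_i' (U i i')%:MP * plane_eqn L c i'.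
  rewrite /plane_eqn ME.
  under [RHS]eq_bigr => i' _ do rewrite c0 mpolyC0 addr0 mul_mpolyC scaler_sumr.
  rewrite exchange_big; apply: eq_bigr => j _.
  rewrite mxE scaler_suml; apply: eq_bigr => i' _.
  by rewrite scalerA.
apply: big_ind => // i' _; apply: JM; exact: ideal_addr.
Qed.

End Quotient.

(** * Hypersurface of low degree from a nonzero minor *)

Section SpecialDirections.
Variables (F : fieldType) (n k m : nat) (hkn : (k <= n)%N).
Variables (I : {mpoly F[n]} -> Prop) (N : nat) (A : quot_basis I N).
Hypotheses (m0 : (0 < m)%N) (idealI : is_ideal I) (suppI : supported_at_origin I).
Variables (s : 'S_n)
  (fg : {ffun 'I_(minor_size m N) -> 'I_(n - k) * 'I_N} *
        {ffun 'I_(minor_size m N) -> 'I_N}).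
Local Notation minor := (Phi_minor hkn A s fg).

Lemma boxdeg_Phi_minor : boxdeg N minor.
Proof.
have Phi1 ia b : boxdeg 1 (Phi hkn A s ia b).
  apply: boxdeg_sum => j; apply: (@boxdegM _ _ 1 0); last exact: boxdegC.
  case: (chart_colP hkn s j) => [a|c].
    by rewrite taut_col_id -[(_ == _)%:R]mpolyC_nat; apply: boxdegC.
  by rewrite taut_col_var; apply: boxdegXm => i; rewrite mnm1E; case: eqP.
apply: (@boxdegW _ _ (minor_size m N)).
  by rewrite /minor_size leq_subLR -add1n leq_add2r.
apply: boxdeg_sum => sg; apply: (@boxdegM _ _ 0).
  by rewrite -signr_odd; case: odd; rewrite ?expr0 ?expr1 -?mpolyCN; apply: boxdegC.
apply: (@boxdegW _ _ (\sum_(i < minor_size m N) 1)%N).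
  by rewrite sum_nat_const card_ord muln1.
apply: (big_ind2 (fun a p => boxdeg a p)) => [|a p b q|i _].
- exact: boxdegC.
- exact: boxdegM.
- by rewrite mxE.
Qed.

(** At the chart point of [w] the map is killed by a matrix of rank [d >= 2 * m], so its rank is at
    most [N - d], while the minor has size [N + 1 - m]; the difference is at least [m + 1]. *)
Lemma vanish_order_Phi_minor (w : 'M[F]_(k, n)) :
  Sigma I (2 * m) w -> colsub (col_var hkn s) w \in unitmx ->
  vanish_order m (shift (chart_coord hkn s w) minor).
Proof.
move=> Sw wu; set v := chart_coord hkn s w.
pose M := map_mx (meval v) (taut_mx F hkn s).
have mm : (0 < 2 * m)%N by rewrite muln_gt0.
have [d md [T rT MT]] := rich_plane_rank idealI A hkn mm suppI Sw
  (taut_chart_coord wu).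
rewrite -det_map_mx; apply: vanish_orderW (@det_vanish_order _ _ _ _).
set M0 := map_mx _ _.
pose Ro : 'M[F]_(minor_size m N, N) := \matrix_p
  qcoord A ((\sum_j M (fg.1 p).1 j *: 'X_j) * qbasis A (fg.1 p).2).
have M0E : M0 = colsub fg.2 Ro.
  apply/matrixP => p q; rewrite !mxE mcoeff0_shift mulr_suml !raddf_sum /=.
  rewrite summxE; apply: eq_bigr => j _.
  by rewrite mevalM mevalC -scalerAl linearZ /= !mxE.
have RoT : Ro *m T = 0.
  by apply/row_matrixP => p; rewrite row_mul rowK MT row0.
have rM0 : (\rank M0 <= N - d)%N.
  rewrite M0E -(mulmx1 Ro) -mulmx_colsub; apply: leq_trans (mxrankM_maxl _ _) _.
  by rewrite -rT -mxrank_ker; apply: mxrankS; apply/sub_kermxP.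
have dN : (d <= N)%N by rewrite -rT rank_leq_row.
move: rM0 md dN; rewrite /minor_size; lia.
Qed.

Lemma low_degree_hypersurface (D := ((n - k) * k)%N) : (m <= N)%N -> minor != 0 ->
  exists (d : nat) (G : {mpoly F[#|{: plucker_index n k}|]}),
    [/\ Gr_hypersurface d G, (d * m <= (D ^ D.+2).+1 * N)%N &
        forall w : 'M[F]_(k, n), Sigma I (2 * m) w -> zeros_on_Gr G w].
Proof.
move=> mN min0.
pose S v := exists w : 'M[F]_(k, n), [/\ Sigma I (2 * m) w,
  colsub (col_var hkn s) w \in unitmx & v = chart_coord hkn s w].
pose e := (D ^ D.+1 * N %/ m)%N.
have [||g [g0 ge gS]] := @low_degree_of_multiplicity F D S minor N m e min0
  boxdeg_Phi_minor m0.
- by move=> _ [w [Sw wu ->]]; apply: vanish_order_Phi_minor.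
- exact: ltn_ceil.
have [l gl|G GH Gw] := @chart_hypersurface n k hkn s F g (D * e) g0.
  rewrite mdegE -[X in (_ <= X * _)%N]card_ord -sum_nat_const.
  by apply: leq_sum => i _; apply: ge gl i.
(* Box degree [e] in [D] variables gives total degree at most [D * e]. The summand 1 is absorbed in
   the bound through [m <= N]. *)
exists (D * e).+1, G; split=> // [|w Sw].
  have : (e * m <= D ^ D.+1 * N)%N by apply: leq_trunc_div.
  move/(leq_mul (leqnn D)); rewrite !mulnA -expnS => H.
  by rewrite !mulSn; apply: leq_add.
split; first by case: Sw.
by apply: Gw => wu; apply: gS; exists w.
Qed.

End SpecialDirections.

Lemma Sigma_leq_dim (F : fieldType) (n k m : nat) (hkn : (k <= n)%N)
    (I : {mpoly F[n]} -> Prop) (N : nat) (A : quot_basis I N) (w : 'M[F]_(k, n)) :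
  is_ideal I -> supported_at_origin I -> (0 < m)%N -> Sigma I m w -> (m <= N)%N.
Proof.
move=> idI suppI m0 Sw.
(* With the zero matrix of forms the annihilation is void and only the rank of [T] is retained. *)
have [|d md [T rT _]] := @rich_plane_rank F n I idI N A m k hkn w 0 m0 suppI Sw.
  by rewrite trmx0 mulmx0.
by apply: leq_trans md _; rewrite -rT rank_leq_row.
Qed.

(** * Rank over the field of fractions *)

Lemma fraction_repr (P : idomainType) (x : {fraction P}) :
  exists2 d, d != 0 & exists n, tofrac d * x = tofrac n.
Proof.
elim/quotW: x => y; exists \d_y; first exact: denom_ratioP.
exists \n_y; rewrite !piE; apply/eqmodP.
rewrite /= FracField.equivfE /FracField.mulf.
rewrite !numden_Ratio ?mulf_neq0 ?oner_eq0 ?denom_ratioP //.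
by rewrite mul1r mulr1 mulrC.
Qed.

Lemma clear_denominators (P : idomainType) (J : finType) (c : J -> {fraction P}) :
  exists2 d, d != 0 & exists c' : J -> P, forall j, tofrac d * c j = tofrac (c' j).
Proof.
have /choice[d dP] : forall j, exists d : P, d != 0 /\ exists n, tofrac d * c j = tofrac n.
  by move=> j; have [d d0 [n dn]] := fraction_repr (c j); exists d; split=> //; exists n.
exists (\prod_j d j).
  by apply/prodf_neq0 => j _; have [] := dP j.
have /choice[n nP] : forall j, exists n, tofrac (d j) * c j = tofrac n.
  by move=> j; have [] := dP j.
exists (fun j => (\prod_(i | i != j) d i) * n j) => j.
rewrite [X in tofrac X * _](bigD1 j) //= [RHS]tofracM -nP tofracM.
by rewrite mulrA (mulrC (tofrac (d j))).
Qed.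

Lemma row_free_rowsub (K : fieldType) r t c (f : 'I_t -> 'I_r) (M : 'M[K]_(r, c)) :
  injective f -> row_free M -> row_free (rowsub f M).
Proof.
move=> finj /row_freeP[B MB]; apply/row_freeP.
exists (B *m colsub f 1%:M); rewrite mulmxA mul_rowsub_mx MB mulmx_colsub mulmx1.
by apply/matrixP => i j; rewrite !mxE (inj_eq finj).
Qed.

Lemma nonzero_minor (K : fieldType) r c t (M : 'M[K]_(r, c)) : (t <= \rank M)%N ->
  exists (f : 'I_t -> 'I_r) (g : 'I_t -> 'I_c), \det (mxsub f g M) != 0.
Proof.
move=> tr.
have winj p (le_t : (t <= p)%N) : injective (widen_ord le_t).
  by move=> i j /(congr1 val) /= ij; apply: val_inj.
pose f i := maxrankfun M (widen_ord tr i).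
have free_f : row_free (rowsub f M).
  have -> : rowsub f M = rowsub (widen_ord tr) (rowsub (maxrankfun M) M).
    by apply/matrixP => i j; rewrite !mxE.
  exact: row_free_rowsub (maxrowsub_free M).
pose B := (rowsub f M)^T.
have rB : \rank B = t by rewrite mxrank_tr; apply/eqP.
have tB : (t <= \rank B)%N by rewrite rB.
pose g i := maxrankfun B (widen_ord tB i).
exists f, g.
have : row_free (rowsub g B).
  have -> : rowsub g B = rowsub (widen_ord tB) (rowsub (maxrankfun B) B).
    by apply/matrixP => i j; rewrite !mxE.
  exact: row_free_rowsub (maxrowsub_free B).
have -> : rowsub g B = (mxsub f g M)^T by apply/matrixP => i j; rewrite !mxE.
by rewrite row_free_unit unitmxE det_tr unitfE.
Qed.

(** A relation over the field of fractions, with denominators cleared. Coefficients in [P] itself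
    are needed for the substitution in the variables [Y] later on. *)
Lemma domain_dependence (P : idomainType) (J : finType) N (v : J -> 'rV[P]_N) :
  (N < #|J|)%N -> exists2 c : J -> P, (exists j, c j != 0) & \sum_j c j *: v j = 0.
Proof.
move=> NJ; have [|c [j1 cj1] c0] := @linear_dependence {fraction P} J 'I_N
  (fun j x => tofrac (v j 0 x)); first by rewrite card_ord.
have [d d0 [c' c'E]] := clear_denominators c.
exists c'.
  by exists j1; rewrite -tofrac_eq0 -c'E mulf_eq0 negb_or cj1 tofrac_eq0 d0.
apply/rowP => x; apply/eqP; rewrite [X in _ == X]mxE -tofrac_eq0; apply/eqP.
have := congr1 ( *%R (tofrac d)) (c0 x); rewrite mulr0 mulr_sumr => c0x.
rewrite summxE raddf_sum -[RHS]c0x.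
by apply: eq_bigr => j _; rewrite mulrA c'E /= mxE tofracM.
Qed.

(** * Down-closed sets of monomials *)

Section DownSets.
Variables (n k d R : nat) (v : 'I_k -> 'I_n) (T : {set 'X_{1..n < d}}).
Hypotheses (k0 : (0 < k)%N) (R0 : (0 < R)%N).
Hypothesis downT : forall mu nu : 'X_{1..n < d}, mu \in T ->
  (val nu <= val mu)%MM -> nu \in T.
Hypothesis suppT : forall mu nu : 'X_{1..n < d}, mu \in T -> nu \in T ->
  (forall b, val mu (v b) = val nu (v b)) -> mu = nu.

Definition movable : {set 'X_{1..n < d}} :=
  [set mu in T | [exists b, exists nu, (nu \in T) &&
     (val nu == val mu + U_(v b) *+ R)%MM]].

Let U := T :\: movable.

Definition bmnm_sub (mu : 'X_{1..n < d}) (nu : 'X_{1..n}) : 'X_{1..n < d} :=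
  BMultinom (leq_ltn_trans (mdegB (val mu) nu) (bmdeg mu)).

(* The [s] translates [mu - i R e_b] of an element that cannot be moved up by
   [R e_b] are distinct elements of [T]. *)
Lemma stuck_long s b :
  (s * #|[set mu in U | (s * R <= val mu (v b))%N]| <= #|T|)%N.
Proof.
set Ub := [set mu in U | _].
pose f (x : 'X_{1..n < d} * 'I_s) := bmnm_sub x.1 (U_(v b) *+ (x.2 * R))%MM.
have le_i mu (i : 'I_s) : mu \in Ub -> (U_(v b) *+ (i * R) <= val mu)%MM.
  rewrite inE => /andP[_ mub]; apply/mnm_lepP => j; rewrite mulmnE mnm1E.
  case: eqP => [<-|_]; last by rewrite mul0n.
  by rewrite mul1n; apply: leq_trans mub; rewrite leq_mul2r ltnW ?orbT.
have stuck mu nu (i j : 'I_s) : mu \in Ub -> nu \in Ub -> f (mu, i) = f (nu, j) ->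
    (i < j)%N -> False.
  move=> muU nuU /(congr1 val) /= fE ij.
  have munu : val nu = (val mu + U_(v b) *+ ((j - i) * R))%MM.
    rewrite -(submK (le_i _ j nuU)) -fE.
    apply/mnmP => l; rewrite !(mnmDE, mnmBE, mulmnE).
    have /mnm_lepP/(_ l) := le_i _ i muU; rewrite mulmnE.
    have : (i * R <= j * R)%N by rewrite leq_mul2r ltnW ?orbT.
    rewrite mulnBl mulnBr; move: (i * R)%N (j * R)%N => x y xy.
    rewrite -[(mu : 'X_{1..n}) l]/(val mu l).
    have := leq_mul (leqnn (U_(v b)%MM l)) xy; lia.
  move: muU; rewrite !inE => /andP[/andP[+ muT] _].
  rewrite muT /= => /negP; apply; apply/existsP; exists b; apply/existsP.
  have le_nu : (val mu + U_(v b) *+ R <= val nu)%MM.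
    rewrite munu; apply/mnm_lepP => l; rewrite !(mnmDE, mulmnE) leq_add2l.
    by rewrite leq_mul2l leq_pmull ?orbT // subn_gt0.
  have db : (mdeg (val mu + U_(v b) *+ R)%MM < d)%N.
    by apply: leq_ltn_trans (bmdeg nu); apply: lemc_mdeg; apply: lem_leo.
  exists (BMultinom db); rewrite /= eqxx andbT.
  by apply: (@downT nu) => //; move: nuU; rewrite !inE => /andP[/andP[]].
rewrite mulnC -[s]card_ord -cardsT -cardsX.
rewrite -(@card_in_imset _ _ f (setX Ub [set: 'I_s])).
  apply: subset_leq_card; apply/subsetP => _ /imsetP[[mu i] /setXP[muU _] ->].
  apply: (downT (mu := mu)); last exact: lem_subr.
  by move: muU; rewrite !inE => /andP[/andP[]].
move=> [mu i] [nu j] /setXP[/= muU _] /setXP[/= nuU _] fE.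
have ij : i = j.
  apply: val_inj => /=; case: (ltngtP i j) => // ij.
    by case: (stuck _ _ _ _ muU nuU fE).
  by case: (stuck _ _ _ _ nuU muU (esym fE)).
subst j; congr (_, _); apply: val_inj => /=.
move/(congr1 val): fE => /= fE.
by rewrite -(submK (le_i _ i muU)) fE submK ?le_i.
Qed.

(** By [suppT] an element of [T] is determined by its [k] exponents at the [v b], each of which has
    [a] possible values here. *)
Lemma stuck_short a : (#|[set mu in U | [forall b, val mu (v b) < a]]| <= a ^ k)%N.
Proof.
case: a => [|a].
  rewrite exp0n // leqn0 cards_eq0; apply/eqP/setP => mu.
  rewrite !inE; apply/negbTE; rewrite negb_and; apply/orP; right.
  by apply/forallPn; exists (Ordinal k0).
rewrite -[X in (_ <= X ^ _)%N]card_ord -[X in (_ <= _ ^ X)%N]card_ord -card_ffun -cardsT.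
pose f (mu : 'X_{1..n < d}) : {ffun 'I_k -> 'I_a.+1} := [ffun b => inord (val mu (v b))].
rewrite -(@card_in_imset _ _ f).
  by apply: subset_leq_card; apply/subsetP => x; rewrite inE.
move=> mu nu; rewrite !inE => /andP[/andP[_ muT] /forallP mua].
move=> /andP[/andP[_ nuT] /forallP nua] /ffunP fE.
apply: suppT => // b; have := fE b; rewrite !ffunE => /(congr1 val) /=.
by rewrite !inordK.
Qed.

(** Elements that cannot be moved and have an exponent at least [4 * k * R] number at most
    [#|T| / (4 * k)] for each [b], by [stuck_long] with [s = 4 * k], hence a quarter of [T] in all.
    The others are at most a quarter by [stuck_short] and the hypothesis. *)
Lemma leq_card_movable : (4 * (4 * k * R) ^ k <= #|T|)%N -> (#|T| <= 2 * #|movable|)%N.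
Proof.
move=> bigT.
have cardU : (#|U| + #|movable| = #|T|)%N.
  have /setIidPr mT : movable \subset T.
    by apply/subsetP => mu; rewrite inE => /andP[].
  by rewrite -(cardsID movable T) mT addnC.
have UE : U \subset [set mu in U | [forall b, val mu (v b) < 4 * k * R]%N] :|:
    \bigcup_b [set mu in U | (4 * k * R <= val mu (v b))%N].
  apply/subsetP => mu muU; rewrite inE; apply/orP.
  have [/forallP mua|/forallPn[b]] := boolP [forall b, val mu (v b) < 4 * k * R]%N.
    by left; rewrite inE muU; apply/forallP.
  by rewrite -leqNgt => mub; right; apply/bigcupP; exists b; rewrite // inE muU.
have sumU : (\sum_b 4 * k * #|[set mu in U | (4 * k * R <= val mu (v b))%N]| <= k * #|T|)%N.
  rewrite -[X in (_ <= X * _)%N]card_ord -sum_nat_const.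
  by apply: leq_sum => b _; apply: stuck_long.
have {}sumU : (4 * \sum_b #|[set mu in U | (4 * k * R <= val mu (v b))%N]| <= #|T|)%N.
  by rewrite -(leq_pmul2l k0) mulnA (mulnC k) big_distrr.
have cU : (\sum_b #|[set mu in U | (4 * k * R <= val mu (v b))%N]|
    >= #|\bigcup_b [set mu in U | (4 * k * R <= val mu (v b))%N]|)%N.
  apply: (big_ind2 (fun (X : {set 'X_{1..n < d}}) c => #|X| <= c)%N) => //.
    by rewrite cards0.
  move=> X x Y y Xx Yy; rewrite cardsU.
  by apply: leq_trans (leq_subr _ _) (leq_add Xx Yy).
have := subset_leq_card UE; rewrite cardsU.
have := stuck_short (4 * k * R); lia.
Qed.

End DownSets.

(** * Standard monomials on the generic plane *)

Lemma high_degree_in_ideal (F : fieldType) n (I : {mpoly F[n]} -> Prop) :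
  is_ideal I -> supported_at_origin I ->
  exists d, forall mu, (d <= mdeg mu)%N -> I 'X_[mu].
Proof.
move=> idI /choice[e eP]; exists (\sum_j e j).+1 => mu dmu.
have [j ej] : exists j, (e j <= mu j)%N.
  apply: contrapT => noj; move: dmu; rewrite ltnNge mdegE => /negP; apply.
  apply: leq_sum => j _; rewrite leqNgt; apply/negP => /ltnW ej.
  by apply: noj; exists j.
have le_mu : (U_(j) *+ e j <= mu)%MM.
  apply/mnm_lepP => i; rewrite mulmnE mnm1E; case: eqP => [<-|_] //.
  by rewrite mul1n.
by rewrite -(submK le_mu) mpolyXD -mpolyXn; apply: idealMl.
Qed.

Section ScalarExtension.
Variables (F : fieldType) (n : nat) (I : {mpoly F[n]} -> Prop) (N d : nat).
Variables (A : quot_basis I N) (idealI : is_ideal I).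
Hypothesis highI : forall mu, (d <= mdeg mu)%N -> I 'X_[mu].

Section OneRing.
Variables (L : comNzRingType) (h : {rmorphism F -> L}).
Implicit Types p q : {mpoly L[n]}.

(** The coordinate map of [A] after extension of scalars along [h]. Truncation at degree [d] loses
    nothing, since monomials of higher degree lie in [I]. *)
Definition qc p : 'rV[L]_N :=
  \sum_(mu : 'X_{1..n < d}) p@_mu *: map_mx h (qcoord A 'X_[mu]).

Lemma qc_is_linear : linear qc.
Proof.
move=> c p q; rewrite /qc scaler_sumr -big_split; apply: eq_bigr => mu _.
by rewrite mcoeffD mcoeffZ scalerDl scalerA.
Qed.

HB.instance Definition _ := GRing.isLinear.Build L {mpoly L[n]} 'rV[L]_N *:%R qc
  qc_is_linear.

Lemma qcX mu : qc 'X_[mu] = map_mx h (qcoord A 'X_[mu]).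
Proof.
have [dmu|mud] := leqP d (mdeg mu).
  rewrite /qc big1 => [|nu _].
    have /(qcoord_ker A) -> := highI dmu.
    by rewrite map_mx0.
  rewrite mcoeffX; have [munu|_] := eqVneq mu nu; last by rewrite scale0r.
  by have := bmdeg nu; rewrite -munu ltnNge dmu.
rewrite /qc (bigD1 (BMultinom mud)) //= mcoeffX eqxx scale1r big1 ?addr0 // => nu.
rewrite -val_eqE /= mcoeffX eq_sym => /negPf ->.
by rewrite scale0r.
Qed.

Lemma qc_mulX j p : qc ('X_j * p) = qc p *m map_mx h (mulX_mx A j).
Proof.
rewrite [p]mpolyE mulr_sumr !raddf_sum mulmx_suml; apply: eq_bigr => mu _.
rewrite /= -scalerAr !linearZ /= -scalemxAl; congr (_ *: _).
by rewrite -mpolyXD !qcX -map_mxM mpolyXD qcoord_mulX.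
Qed.

End OneRing.

Lemma qc_map (L L' : comNzRingType) (h : {rmorphism F -> L})
    (h' : {rmorphism F -> L'}) (g : {rmorphism L -> L'}) p :
  (forall c, g (h c) = h' c) -> qc h' (map_mpoly g p) = map_mx g (qc h p).
Proof.
move=> gh; rewrite /qc raddf_sum; apply: eq_bigr => mu _.
by apply/rowP => b; rewrite mcoeff_map_mpoly /= !mxE rmorphM /= gh.
Qed.

Section Forms.
Variables (k : nat) (hkn : (k <= n)%N).
Local Notation cI := (col_id hkn 1%g).
Local Notation cV := (col_var hkn 1%g).

Section OneRing.
Variables (L : comNzRingType) (h : {rmorphism F -> L}) (y : 'I_(n - k) -> 'I_k -> L).

Definition chart_form i : {mpoly L[n]} := 'X_(cI i) + \sum_b y i b *: 'X_(cV b).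

Definition chart_form_mx i : 'M[L]_N :=
  map_mx h (mulX_mx A (cI i)) + \sum_b y i b *: map_mx h (mulX_mx A (cV b)).

Lemma qc_mul_form i p : qc h (chart_form i * p) = qc h p *m chart_form_mx i.
Proof.
rewrite mulrDl linearD /= qc_mulX mulmxDr; congr (_ + _).
rewrite mulr_suml raddf_sum mulmx_sumr; apply: eq_bigr => b _.
by rewrite /= -scalerAl linearZ /= qc_mulX -scalemxAr.
Qed.

Lemma chart_form_mxC i j :
  chart_form_mx i *m map_mx h (mulX_mx A j) = map_mx h (mulX_mx A j) *m chart_form_mx i.
Proof.
rewrite /chart_form_mx mulmxDl mulmxDr -!map_mxM (mulX_mxC idealI); congr (_ + _).
rewrite mulmx_suml mulmx_sumr; apply: eq_bigr => b _.
by rewrite -scalemxAl -scalemxAr -!map_mxM (mulX_mxC idealI).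
Qed.

End OneRing.

Local Notation P := {mpoly F[(n - k) * k]}.
Local Notation K := {fraction P}.
Local Notation hP := (@mpolyC ((n - k) * k) F : {rmorphism F -> P}).
Local Notation hK := (tofrac \o hP : {rmorphism F -> K}).

Definition gen_coord i b : P := 'X_(mxvec_index i b).
Local Notation yK := (fun i b => tofrac (gen_coord i b)).

(** Its row space is the ideal generated by the generic forms in [A] extended to [K]; the quotient
    by it is the coordinate ring of the intersection with the generic plane. *)
Definition gen_Phi : 'M[K]_(#|{: 'I_(n - k) * 'I_N}|, N) :=
  \matrix_(r, c) tofrac (Phi hkn A 1%g (enum_val r) c).

Lemma rank_gen_Phi m : X_is_Gr m hkn A -> (\rank gen_Phi < N.+1 - m)%N.
Proof.
move=> XGr; rewrite ltnNge; apply/negP => /nonzero_minor[f [g]].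
pose fg : {ffun 'I_(minor_size m N) -> 'I_(n - k) * 'I_N} *
    {ffun 'I_(minor_size m N) -> 'I_N} := ([ffun p => enum_val (f p)], [ffun p => g p]).
have minor0 : Phi_minor hkn A 1%g fg = 0.
  apply: XGr; exists (fun fg' => (fg' == fg)%:R).
  rewrite (bigD1 fg) //= eqxx mul1r big1 ?addr0 // => fg' /negPf ->.
  by rewrite mul0r.
have -> : mxsub f g gen_Phi = map_mx (tofrac : {rmorphism P -> K})
    (\matrix_(p < minor_size m N, q < minor_size m N) Phi hkn A 1%g (fg.1 p) (fg.2 q)).
  by apply/matrixP => p q; rewrite !mxE !ffunE.
by rewrite det_map_mx -[\det _]/(Phi_minor hkn A 1%g fg) minor0 rmorph0 eqxx.
Qed.

Lemma row_gen_Phi i a : row (enum_rank (i, a)) gen_Phi = row a (chart_form_mx hK yK i).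
Proof.
apply/rowP => c; rewrite mxE mxE enum_rankK /Phi /= rmorph_sum (sum_chart hkn 1%g).
rewrite (bigD1 i) //= [X in _ + X + _]big1 => [|i' i'i]; last first.
  by rewrite taut_col_id eq_sym (negPf i'i) mul0r rmorph0.
rewrite taut_col_id eqxx mul1r addr0 /chart_form_mx !mxE summxE; congr (_ + _).
by apply: eq_bigr => b _; rewrite taut_col_var !mxE rmorphM.
Qed.

Lemma chart_form_mx_sub i : (chart_form_mx hK yK i <= gen_Phi)%MS.
Proof. by apply/row_subP => a; rewrite -row_gen_Phi row_sub. Qed.

Lemma gen_Phi_stable j : (gen_Phi *m map_mx hK (mulX_mx A j) <= gen_Phi)%MS.
Proof.
apply/row_subP => r; rewrite row_mul -[r]enum_valK; case: (enum_val r) => i a.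
rewrite row_gen_Phi rowE -mulmxA chart_form_mxC mulmxA.
exact: submx_trans (submxMl _ _) (chart_form_mx_sub i).
Qed.

Lemma mulXm_mx delta : exists2 M : 'M[K]_N,
  forall p, qc hK ('X_[delta] * p) = qc hK p *m M & (gen_Phi *m M <= gen_Phi)%MS.
Proof.
rewrite mpolyXE_id.
apply: (big_ind (fun q => exists2 M : 'M[K]_N,
  forall p, qc hK (q * p) = qc hK p *m M & (gen_Phi *m M <= gen_Phi)%MS)) => [||i _].
- by exists 1%:M => [p|]; rewrite ?mul1r mulmx1.
- move=> q q' [M qM sM] [M' qM' sM']; exists (M' *m M) => [p|].
    by rewrite -mulrA qM qM' mulmxA.
  by rewrite mulmxA; apply: submx_trans sM; apply: submxMr.
elim: (delta i) => [|e [M qM sM]].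
  by exists 1%:M => [p|]; rewrite ?expr0 ?mul1r mulmx1.
exists (M *m map_mx hK (mulX_mx A i)) => [p|].
  by rewrite exprS -mulrA qc_mulX qM mulmxA.
by rewrite mulmxA; apply: submx_trans (gen_Phi_stable i); apply: submxMr.
Qed.

Local Notation vec mu := (qc hK 'X_[mu]).

(** The ideal of the forms plus the span of the monomials smaller than [mu]. Standard monomials are
    those outside their own [below]. *)
Definition below (mu : 'X_{1..n}) : 'M[K]_N :=
  (gen_Phi + \sum_(nu : 'X_{1..n < d} | (val nu < mu)%O) <<vec (val nu)>>)%MS.

Lemma below_ltr mu nu : (nu < mu)%O -> (vec nu <= below mu)%MS.
Proof.
move=> ltnu; have [dnu|nud] := leqP d (mdeg nu).
  by rewrite qcX; have /(qcoord_ker A) -> := highI dnu; rewrite map_mx0 sub0mx.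
apply: submx_trans (addsmxSr _ _).
apply: (submx_trans _ (sumsmx_sup (BMultinom nud) _ (submx_refl _))) => //=.
by rewrite genmxE.
Qed.

Lemma below_mulX mu delta M (u : 'rV[K]_N) :
  (forall p, qc hK ('X_[delta] * p) = qc hK p *m M) -> (gen_Phi *m M <= gen_Phi)%MS ->
  (u <= below mu)%MS -> (u *m M <= below (delta + mu)%MM)%MS.
Proof.
move=> qM sM /submxMr/submx_trans; apply; rewrite addsmxMr addsmx_sub.
rewrite (submx_trans sM (addsmxSl _ _)) sumsmxMr; apply/sumsmx_subP => nu numu.
rewrite (eqmxMr _ (genmxE _)) -qM -mpolyXD; apply: below_ltr.
by rewrite ltmc_add2r.
Qed.

Definition standard : {set 'X_{1..n < d}} :=
  [set mu | ~~ (vec (val mu) <= below (val mu))%MS].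

Lemma standard_down (mu nu : 'X_{1..n < d}) : mu \in standard ->
  (val nu <= val mu)%MM -> nu \in standard.
Proof.
rewrite !inE => + le_nu; apply: contra => nuB.
have [M qM sM] := mulXm_mx (val mu - val nu)%MM.
by rewrite -{1 2}(submK le_nu) mpolyXD qM; apply: below_mulX.
Qed.

(** Modulo the [i]-th form, [x_(cI i)] is a combination of the [x_(cV b)], which are smaller in the
    monomial order because the columns [cI] come first for the identity permutation. Hence standard
    monomials involve only [k] variables. *)
Lemma standard_var (mu : 'X_{1..n < d}) i : mu \in standard -> val mu (cI i) = 0%N.
Proof.
rewrite inE => muB; apply/eqP; apply: contraNT muB => mui.
have le_mu : (U_(cI i) <= val mu)%MM by rewrite lep1mP.
rewrite -(submK le_mu) addmC; set delta := (_ - _)%MM.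
have -> : 'X_[U_(cI i) + delta] = chart_form yK i * 'X_[delta]
    - \sum_b yK i b *: 'X_[U_(cV b) + delta].
  rewrite mulrDl mulr_suml mpolyXD -addrA [X in _ = _ + X](_ : _ = 0) ?addr0 //.
  apply/eqP; rewrite subr_eq0; apply/eqP; apply: eq_bigr => b _.
  by rewrite mpolyXD -scalerAl.
rewrite linearB /= qc_mul_form; apply: addmx_sub.
  apply: submx_trans (addsmxSl _ _).
  exact: submx_trans (submxMl _ _) (chart_form_mx_sub i).
rewrite eqmx_opp raddf_sum; apply: summx_sub => b _; rewrite /= linearZ /=.
apply: scalemx_sub; apply: below_ltr; rewrite ltmc_add2l.
apply/ltmcP; first by rewrite !mdeg1.
have cIV : (cI i < cV b)%N.
  by rewrite /col_id /col_var invg1 !perm1 /=; apply: ltn_addr.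
exists (cI i) => [j ji|]; rewrite !mnm1E.
  by rewrite -!val_eqE /= !gtn_eqF // (ltn_trans ji).
by rewrite eqxx -val_eqE /= gtn_eqF.
Qed.

(** By induction along the monomial order, every monomial lies in the ideal of the forms plus the
    span of the standard ones. That sum is thus the whole space of dimension [N]. *)
Lemma card_standard m : (m <= N)%N -> (\rank gen_Phi <= N - m)%N -> (m <= #|standard|)%N.
Proof.
move=> mN rPhi.
pose V := (gen_Phi + \sum_(mu in standard) <<vec (val mu)>>)%MS.
have vecV mu : (vec mu <= V)%MS.
  elim/(well_founded_induction (@ltom_wf n)): mu => mu IH.
  have belowV : (below mu <= V)%MS.
    rewrite addsmx_sub addsmxSl; apply/sumsmx_subP => nu numu.
    by rewrite genmxE IH.
  have [dmu|mud] := leqP d (mdeg mu).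
    by rewrite qcX; have /(qcoord_ker A) -> := highI dmu; rewrite map_mx0 sub0mx.
  have [muS|] := boolP (BMultinom mud \in standard); last first.
    by rewrite inE negbK => /submx_trans; apply.
  apply: submx_trans (addsmxSr _ _).
  apply: (submx_trans _ (sumsmx_sup (BMultinom mud) muS (submx_refl _))).
  by rewrite genmxE.
have fullV : (1%:M <= V)%MS.
  apply/row_subP => a; rewrite row1.
  have -> : delta_mx 0 a = map_mx hK (qcoord A (qbasis A a)).
    by rewrite qcoord_basis map_delta_mx.
  rewrite (mpolyE (qbasis A a)) raddf_sum map_mx_sum; apply: summx_sub => mu _.
  by rewrite /= linearZ map_mxZ; apply: scalemx_sub; rewrite -qcX.
have /mxrankS := fullV; rewrite mxrank1 => rV.
have rS : (\rank (\sum_(mu in standard) <<vec (val mu)>>)%MS <= #|standard|)%N.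
  rewrite -sum1_card; apply: leq_trans (mxrank_sum_leqif _) _ => /=.
  by apply: leq_sum => mu _; rewrite genmxE rank_leq_row.
have := leq_trans rV (mxrank_adds_leqif _ _); lia.
Qed.

End Forms.

End ScalarExtension.

(** * Linear independence *)

Lemma mcoeffMX_min (R : comNzRingType) l (p : {mpoly R[l]}) (beta gamma : 'X_{1..l}) :
  (mdeg gamma <= mdeg beta)%N ->
  (p * 'X_[beta])@_gamma = if beta == gamma then p@_0%MM else 0.
Proof.
move=> le_gb; have [->|bg] := eqVneq; first exact: mcoeffMX0.
apply/eqP; apply: contraNT bg => /mcoeffM_neq0[m1 [m2 [gE _]]].
rewrite mcoeffX; have [m2E _|] := eqVneq beta m2; last by rewrite eqxx.
move: le_gb; rewrite gE -m2E mdegD -[X in (_ <= X)%N]add0n leq_add2r leqn0 mdeg_eq0.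
by move=> /eqP ->; rewrite add0m.
Qed.


(** [psi] stands for reduction modulo an ideal: congruence under all multipliers [t] is compatible
    with products and powers. *)
Lemma eq_prod_exp_mod (S : comNzRingType) (V : Type) (psi : S -> V) (J : finType)
    (f g : J -> S) (e : J -> nat) t :
  (forall j t, psi (f j * t) = psi (g j * t)) ->
  psi ((\prod_j f j ^+ e j) * t) = psi ((\prod_j g j ^+ e j) * t).
Proof.
move=> fg; pose eqv p q := forall t, psi (p * t) = psi (q * t).
have eqvM p q p' q' : eqv p q -> eqv p' q' -> eqv (p * p') (q * q').
  by move=> pq pq' t'; rewrite -mulrA pq mulrCA pq' mulrCA mulrA.
have eqvX p q a : eqv p q -> eqv (p ^+ a) (q ^+ a).
  by move=> pq; elim: a => // a IH; rewrite !exprS; apply: eqvM.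
suff : eqv (\prod_j f j ^+ e j) (\prod_j g j ^+ e j) by apply.
apply: (big_ind2 eqv) => [//|p q p' q'|j _]; first exact: eqvM.
by apply: eqvX; apply: fg.
Qed.

(* Reduction modulo the forms [l_i = x_i + sum_b y_ib x_b] (here: multiplication
   by [C]) after the substitution [y_ib -> y_ib + e_i] for one fixed [b], under
   which [l_i] becomes [e_i x_b]. The [e_i] are the variables of [E]. *)
Section Perturbation.
Variables (F : fieldType) (n : nat) (I : {mpoly F[n]} -> Prop) (N d : nat).
Variables (A : quot_basis I N) (idealI : is_ideal I).
Hypothesis highI : forall mu, (d <= mdeg mu)%N -> I 'X_[mu].
Variables (k : nat) (hkn : (k <= n)%N).
Local Notation cI := (col_id hkn 1%g).
Local Notation cV := (col_var hkn 1%g).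
Variables (P K : comNzRingType) (hP : {rmorphism F -> P}) (hK : {rmorphism F -> K}).
Local Notation E := {mpoly K[n - k]}.
Local Notation cE := (@mpolyC (n - k) K : {rmorphism K -> E}).
Local Notation hE := (cE \o hK : {rmorphism F -> E}).
Variables (yP : 'I_(n - k) -> 'I_k -> P) (yK : 'I_(n - k) -> 'I_k -> K).
Local Notation yE := (fun i b => cE (yK i b)).
Variables (b : 'I_k) (perturb : {rmorphism P -> E}).
Hypothesis perturb_scalar : forall c, perturb (hP c) = hE c.
Hypothesis perturb_coord : forall i b',
  perturb (yP i b') = cE (yK i b') + (b' == b)%:R * 'X_i.
Local Notation vec mu := (qc d A hK 'X_[mu]).

Lemma perturb_form i :
  map_mpoly perturb (chart_form hkn yP i) =
    chart_form hkn yE i + 'X_i *: 'X_(cV b).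
Proof.
rewrite rmorphD /= map_mpolyX -addrA; congr (_ + _).
rewrite raddf_sum /= (bigD1 b) //= [in RHS](bigD1 b) //= addrAC.
have formE b' : map_mpoly perturb (yP i b' *: 'X_(cV b')) =
    (cE (yK i b') + (b' == b)%:R * 'X_i) *: 'X_(cV b').
  by rewrite map_mpolyZ map_mpolyX /= perturb_coord.
rewrite formE eqxx mul1r scalerDl; congr (_ + _); apply: eq_bigr => b' /negPf b'b.
by rewrite formE b'b mul0r addr0.
Qed.

Variable C : 'M[K]_N.
Hypothesis formsC : forall i, chart_form_mx A hkn hK yK i *m C = 0.

Definition mod_forms (p : {mpoly E[n]}) : 'rV[E]_N := qc d A hE p *m map_mx cE C.

Lemma mod_formsX mu : mod_forms 'X_[mu] = map_mx cE (vec mu *m C).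
Proof.
rewrite /mod_forms [RHS]map_mxM !qcX //; congr (_ *m _).
by apply/rowP => c; rewrite !mxE.
Qed.

Lemma mod_forms0 i p : mod_forms (chart_form hkn yE i * p) = 0.
Proof.
rewrite /mod_forms qc_mul_form // -mulmxA.
have -> : chart_form_mx A hkn hE yE i = map_mx cE (chart_form_mx A hkn hK yK i).
  apply/matrixP => a c; rewrite !mxE !summxE raddfD raddf_sum /=.
  by congr (_ + _); apply: eq_bigr => b' _; rewrite !mxE rmorphM.
by rewrite -map_mxM formsC map_mx0 mulmx0.
Qed.

Lemma mod_forms_perturb (alpha : 'X_{1..n - k}) mu :
  mod_forms (map_mpoly perturb
    ((\prod_i chart_form hkn yP i ^+ alpha i) * 'X_[mu])) =
  'X_[alpha] *: map_mx cE (vec (U_(cV b) *+ mdeg alpha + mu)%MM *m C).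
Proof.
rewrite rmorphM /= rmorph_prod map_mpolyX /=.
under eq_bigr do rewrite rmorphXn /= perturb_form.
rewrite (@eq_prod_exp_mod _ _ mod_forms _ _ (fun i => 'X_i *: 'X_(cV b))); last first.
  move=> i t; rewrite mulrDl /mod_forms linearD mulmxDl -[RHS]add0r.
  by congr (_ + _); apply: mod_forms0.
under eq_bigr do rewrite exprZn.
rewrite scaler_prod -mpolyXE_id prodrXr -mdegE mpolyXn -scalerAl -mpolyXD.
by rewrite /mod_forms linearZ -scalemxAl -/(mod_forms _) mod_formsX.
Qed.

Variables (frac : {rmorphism P -> K}).
Hypothesis mcoeff0_perturb : forall c, (perturb c)@_0%MM = frac c.

(** The perturbed term [j] is [perturb (c j)] times the monomial [e ^ (al j)] times a constant
    vector. Taking the coefficient of [e ^ al0], of minimal degree, leaves the terms with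
    [al j = al0] and the constant term of [perturb (c j)], which is [frac (c j)]. *)
Lemma lowest_coeffs r (J : finType) (al : J -> {ffun 'I_(n - k) -> 'I_r})
    (std : J -> 'X_{1..n}) (c : J -> P) al0 :
  \sum_j c j *: qc d A hP
    ((\prod_i chart_form hkn yP i ^+ (box_mnm (al j) i)) * 'X_[std j]) = 0 ->
  (forall j, c j != 0 -> (mdeg (box_mnm al0) <= mdeg (box_mnm (al j)))%N) ->
  (\sum_(j | al j == al0) frac (c j) *:
    vec (U_(cV b) *+ mdeg (box_mnm al0) + std j)%MM) *m C = 0.
Proof.
move=> c0 min0; pose w j : {mpoly P[n]} :=
  (\prod_i chart_form hkn yP i ^+ (box_mnm (al j) i)) * 'X_[std j].
apply/rowP => x.
pose u j := (vec (U_(cV b) *+ mdeg (box_mnm (al j)) + std j)%MM *m C) 0 x.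
have /(congr1 (fun M => (map_mx perturb M *m map_mx cE C) 0 x)) := c0.
rewrite raddf_sum mulmx_suml summxE /= map_mx0 mul0mx mxE.
move/(congr1 (mcoeff (box_mnm al0))); rewrite raddf_sum mcoeff0 => c0x.
rewrite [RHS]mxE -[RHS]c0x mulmx_suml summxE [RHS](bigID (fun j => al j == al0)) /=.
have termE j : (map_mx perturb (c j *: qc d A hP (w j)) *m map_mx cE C) 0 x
    = perturb (c j) * 'X_[box_mnm (al j)] * cE (u j).
  have qE : qc d A hE (map_mpoly perturb (w j)) = map_mx perturb (qc d A hP (w j)).
    by apply: qc_map => a; apply: perturb_scalar.
  rewrite map_mxZ -qE -scalemxAl -/(mod_forms _) mod_forms_perturb scalerA.
  by rewrite mxE [X in _ * X]mxE.
rewrite [X in _ = _ + X]big1 ?addr0.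
  apply: eq_bigr => j /eqP jj0; rewrite termE jj0 mulrC mcoeffCM mcoeffMX0.
  by rewrite mcoeff0_perturb -scalemxAl mxE mulrC /u jj0.
move=> j /negPf jj0; rewrite termE mulrC mcoeffCM.
have [->|cj] := eqVneq (c j) 0; first by rewrite rmorph0 mul0r mcoeff0 mulr0.
by rewrite mcoeffMX_min ?min0 // (inj_eq (@box_mnm_inj _ _)) jj0 mulr0.
Qed.

End Perturbation.

(** * Independence of products of forms and standard monomials *)

Section Independence.
Variables (F : fieldType) (n : nat) (I : {mpoly F[n]} -> Prop) (N d : nat).
Variables (A : quot_basis I N) (idealI : is_ideal I).
Hypothesis highI : forall mu, (d <= mdeg mu)%N -> I 'X_[mu].
Variables (k : nat) (hkn : (k <= n)%N).
Local Notation cI := (col_id hkn 1%g).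
Local Notation cV := (col_var hkn 1%g).
Local Notation P := {mpoly F[(n - k) * k]}.
Local Notation K := {fraction P}.
Local Notation E := {mpoly K[n - k]}.
Local Notation hP := (@mpolyC ((n - k) * k) F : {rmorphism F -> P}).
Local Notation hK := (tofrac \o hP : {rmorphism F -> K}).
Local Notation cE := (@mpolyC (n - k) K : {rmorphism K -> E}).
Local Notation hE := (cE \o hK : {rmorphism F -> E}).
Local Notation yP := (@gen_coord F n k).
Local Notation yK := (fun i b => tofrac (yP i b)).
Local Notation vec mu := (qc d A hK 'X_[mu]).

(** The substitution starts from [P] and not from [K]: perturbed denominators need not be invertible
    in the polynomial ring [E]. *)
Definition perturb (b : 'I_k) : P -> E :=
  mmap hE (fun l => cE (tofrac 'X_l) +
    mxvec (\matrix_(i, b') ((b' == b)%:R * 'X_i)) 0 l).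

HB.instance Definition _ b := GRing.RMorphism.copy (perturb b)
  (mmap hE (fun l => cE (tofrac 'X_l) +
    mxvec (\matrix_(i, b') ((b' == b)%:R * 'X_i)) 0 l)).

Lemma perturbC b c : perturb b (hP c) = hE c.
Proof. exact: mmapC. Qed.

Lemma perturb_gen_coord b i b' :
  perturb b (yP i b') = cE (yK i b') + (b' == b)%:R * 'X_i.
Proof. by rewrite /perturb mmapX mmap1U mxvecE mxE. Qed.

Lemma mcoeff0_perturb b c : (perturb b c)@_0%MM = tofrac c.
Proof.
rewrite {2}[c]mpolyE /perturb /mmap !raddf_sum; apply: eq_bigr => mu _ /=.
rewrite -mul_mpolyC [LHS]rmorphM [RHS]rmorphM /= mpolyCK; congr (_ * _).
rewrite /mmap1 mpolyXE_id [LHS]rmorph_prod [RHS]rmorph_prod /=; apply: eq_bigr => l _.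
rewrite !rmorphXn /= mcoeffD mcoeffC eqxx mulr1.
case/mxvec_indexP: l => i b'; rewrite mxvecE mxE.
by rewrite -mpolyC_nat mcoeffCM mcoeffX mnm1_eq0 mulr0 addr0.
Qed.

Variables (r R : nat).
Hypothesis boxR : ((n - k) * r <= R)%N.
Local Notation T' := (movable R cV (standard d A hkn)).
Local Notation J := ({ffun 'I_(n - k) -> 'I_r} * {mu : 'X_{1..n < d} | mu \in T'})%type.
Local Notation std j := (val (sval (snd j))).

Definition form_mnm (j : J) : {mpoly P[n]} :=
  (\prod_i chart_form hkn yP i ^+ (box_mnm j.1 i)) * 'X_[std j].

Lemma gen_lowest_coeffs (c : J -> P) (j0 : J) b :
  \sum_j c j *: qc d A hP (form_mnm j) = 0 ->
  (forall j, c j != 0 -> (mdeg (box_mnm j0.1) <= mdeg (box_mnm j.1))%N) ->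
  ((\sum_(j | j.1 == j0.1) tofrac (c j) *:
    vec (U_(cV b) *+ mdeg (box_mnm j0.1) + std j)%MM)%R <= gen_Phi A hkn)%MS.
Proof.
move=> c0 min0; rewrite submxE; apply/eqP.
apply: (lowest_coeffs idealI highI (perturbC b) (perturb_gen_coord b) _
  (mcoeff0_perturb b) (std := fun j => std j) (al := fst) c0 min0).
by move=> i; apply/eqP; rewrite -submxE; apply: chart_form_mx_sub.
Qed.

Lemma independence : (r ^ (n - k) * #|T'| <= N)%N.
Proof.
rewrite leqNgt; apply/negP => ltN.
have [|c' [j1 c'j1] c'0] := domain_dependence (fun j => qc d A hP (form_mnm j)).
  by rewrite card_prod card_ffun !card_ord card_sig.
pose j0 := [arg min_(j < j1 | c' j != 0%R) mdeg (box_mnm j.1)]%N.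
have [cj0 min0] : c' j0 != 0 /\
    forall j, c' j != 0 -> (mdeg (box_mnm j0.1) <= mdeg (box_mnm j.1))%N.
  by rewrite /j0; case: arg_minnP.
pose Q := [pred j : J | (c' j != 0) && (j.1 == j0.1)].
have Qj0 : Q j0 by rewrite /= cj0 eqxx.
(* Among the terms whose exponent of the forms equals that of [j0], take the one with the largest
   monomial. *)
pose j2 := [arg max_(j > j0 | Q j) std j]%O.
have [/andP[cj2 /eqP j20] max2] : Q j2 /\ forall j, Q j -> (std j <= std j2)%O.
  by rewrite /j2; case: Order.TotalTheory.arg_maxP.
(* The variable [b] to perturb is dictated by this leading monomial: it stays standard when
   multiplied by [x_b ^ R], hence also by [x_b ^ a] with [a <= R]. The relation of lowest order puts
   that product into its own [below], a contradiction. *)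
have := valP j2.2; rewrite inE => /andP[_ /existsP[b /existsP[nu /andP[nuS /eqP nuE]]]].
set a := mdeg (box_mnm j0.1).
have aR : (a <= R)%N.
  apply: leq_trans boxR; rewrite /a mdegE -[X in (_ <= X * _)%N]card_ord -sum_nat_const.
  by apply: leq_sum => i _; rewrite mnmE ltnW.
pose nu' := (U_(cV b) *+ a + std j2)%MM.
have le_nu' : (nu' <= val nu)%MM.
  rewrite nuE /nu' [X in (X <= _)%MM]addmC; apply/mnm_lepP => l.
  by rewrite !mnmDE leq_add2l !mulmnE leq_mul2l aR orbT.
have nu'd : (mdeg nu' < d)%N.
  by apply: leq_ltn_trans (bmdeg nu); apply: lemc_mdeg; apply: lem_leo.
have : BMultinom nu'd \in standard d A hkn by apply: standard_down nuS _.
rewrite inE => /negP; apply.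
have := gen_lowest_coeffs b c'0 min0.
rewrite (bigD1 j2) /= ?j20 //; set rest := \sum_(_ | _) _ => sumPhi.
have restB : (rest <= below d A hkn nu')%MS.
  apply: summx_sub => j /andP[/eqP jj0 jj2].
  have [->|cj] := eqVneq (c' j) 0; first by rewrite tofrac0 scale0r sub0mx.
  apply: scalemx_sub; apply: below_ltr => //; rewrite ltmc_add2r.
  rewrite lt_neqAle max2 /= ?cj ?jj0 ?eqxx // andbT.
  apply: contra jj2 => /eqP stdE; apply/eqP; apply: injective_projections.
    by rewrite jj0 j20.
  by do 2!apply: val_inj.
have : (tofrac (c' j2) *: vec nu' <= below d A hkn nu')%MS.
  rewrite -[_ *: _](addrK rest); apply: addmx_sub; last by rewrite eqmx_opp.
  by apply: submx_trans sumPhi _; apply: addsmxSl.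
by apply: submx_trans; rewrite eqmx_scale // tofrac_eq0.
Qed.

End Independence.

(** * Conclusion *)

Lemma root_floor k q m : (0 < k)%N -> (0 < q)%N ->
  exists r, ((q * r) ^ k <= m)%N && (m < (q * r.+1) ^ k)%N.
Proof.
move=> k0 q0; have bnd r : ((q * r) ^ k <= m)%N -> (r <= m)%N.
  apply: leq_trans; apply: (@leq_trans (q * r)); first exact: leq_pmull.
  by rewrite -{1}[(q * r)%N]expn1; case: (q * r)%N => [|x]; rewrite ?exp0n // leq_pexp2l.
have ex0 : exists r, ((q * r) ^ k <= m)%N by exists 0%N; rewrite muln0 exp0n.
case: (ex_maxnP ex0 bnd) => r rm rmax; exists r; rewrite rm /= ltnNge.
by apply/negP => /rmax; rewrite ltnn.
Qed.

(** With [R = n * r], the factor [16 * k * n] secures the hypothesis of [leq_card_movable], as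
    [4 <= 4 ^ k]. The inner 2 comes from [r + 1 <= 2 * r], the outer one from keeping half of the
    standard monomials. *)
Definition lower_const n k := (2 * (2 * (16 * k * n)) ^ n)%N.

Lemma rich_everywhere_lower_bound (F : fieldType) (n k m : nat) (hkn : (k <= n)%N)
    (I : {mpoly F[n]} -> Prop) (N : nat) (A : quot_basis I N) :
  (0 < k)%N -> (0 < m)%N -> is_ideal I -> supported_at_origin I ->
  X_is_Gr m hkn A -> (m ^ n <= (lower_const n k * N) ^ k)%N.
Proof.
move=> k0 m0 idI suppI XGr.
have [d highI] := high_degree_in_ideal idI suppI.
have rPhi := rank_gen_Phi XGr.
(* A rank below the truncated [N.+1 - m] forces that difference to be positive. *)
have mN : (m <= N)%N by move: rPhi; lia.
have n0 : (0 < n)%N by apply: leq_trans k0 _.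
set q := (16 * k * n)%N.
have q0 : (0 < q)%N by rewrite !muln_gt0 k0 n0.
have [r /andP[qrm mqr]] := root_floor m k0 q0.
(* If [r = 0], then [m < q ^ k] is bounded and [N >= 1] suffices. *)
have [r0|r0] := posnP r.
  apply: (@leq_trans (q ^ (n * k))).
    rewrite mulnC expnM leq_exp2r //; apply: ltnW; by rewrite r0 muln1 in mqr.
  rewrite expnM leq_exp2r // -[X in (X <= _)%N]muln1 leq_mul ?(leq_trans m0) //.
  rewrite /lower_const -/q expnMn mulnA leq_pmull // muln_gt0 expn_gt0 //.
set S := standard d A hkn.
have mS : (m <= #|S|)%N by apply: card_standard => //; move: rPhi; lia.
set T' := movable (n * r) (col_var hkn 1%g) S.
have ST : (#|S| <= 2 * #|T'|)%N.
  apply: leq_card_movable => //.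
  - by rewrite muln_gt0 n0.
  - by move=> mu nu muS le; apply: standard_down muS le.
  - move=> mu nu muS nuS eqv; apply: val_inj; apply/mnmP => j.
    case: (chart_colP hkn 1%g j) => [a|b]; last exact: eqv.
    have := standard_var idI highI a muS; have := standard_var idI highI a nuS.
    by move=> /= -> ->.
  - apply: leq_trans mS; apply: leq_trans qrm.
    apply: (@leq_trans (4 ^ k * (4 * k * (n * r)) ^ k)).
      rewrite leq_mul2r; apply/orP; right.
      by rewrite -{1}(expn1 4) leq_pexp2l.
    by rewrite -expnMn leq_exp2r // /q; lia.
have ind : (r ^ (n - k) * #|T'| <= N)%N.
  by apply: independence => //; rewrite leq_mul2r leq_subr orbT.
have H : (m * r ^ (n - k) <= 2 * N)%N.
  apply: leq_trans (leq_mul (leqnn 2) ind).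
  rewrite mulnCA mulnC leq_mul2l; apply/orP; right.
  exact: leq_trans mS ST.
have -> : (m ^ n = m ^ k * m ^ (n - k))%N by rewrite -expnD subnKC.
(* Only [n - k] of the factors [m] are replaced by [(2 * q * r) ^ k]; the other [k] are kept for the
   bound [m * r ^ (n - k) <= 2 * N]. *)
apply: (@leq_trans (m ^ k * ((2 * q * r) ^ k) ^ (n - k))).
  rewrite leq_mul2l; apply/orP; right.
  have [->|nk] := posnP (n - k)%N; first by rewrite !expn0.
  rewrite leq_exp2r //; apply: leq_trans (ltnW mqr) _; rewrite leq_exp2r //.
  rewrite mulnAC mulnC leq_mul2r; apply/orP; right; lia.
have -> : (m ^ k * ((2 * q * r) ^ k) ^ (n - k) =
    (m * r ^ (n - k) * (2 * q) ^ (n - k)) ^ k)%N.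
  rewrite -expnM (mulnC k) expnM -expnMn; congr (_ ^ k)%N.
  by rewrite expnMn -mulnA; congr (_ * _)%N; exact: mulnC.
rewrite leq_exp2r // /lower_const -/q.
apply: (@leq_trans (2 * N * (2 * q) ^ n)); last by rewrite -!mulnA (mulnC N).
by apply: leq_mul => //; rewrite leq_pexp2l ?leq_subr // muln_gt0.
Qed.

Theorem theorem1p7 (R : realType) (n k : nat) (hk : (1 <= k)%N)
    (hkn : (k <= n)%N) :
  exists C1 C2 : R, 0 < C1 /\ 0 < C2 /\
    forall (F : fieldType) (m : nat) (I : {mpoly F[n]} -> Prop) (N : nat)
        (A : quot_basis I N),
      (0 < m)%N -> homogeneous_ideal I -> supported_at_origin I ->
      (X_is_Gr m hkn A /\ C1 * powR m%:R (n%:R / k%:R) <= N%:R) \/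
      (exists (d : nat) (G : {mpoly F[#|{: plucker_index n k}|]}),
         [/\ Gr_hypersurface d G, d%:R <= C2 * (N%:R / m%:R) &
             forall w : 'M[F]_(k, n),
               Sigma I (2 * m) w -> zeros_on_Gr G w]).
Proof.
pose D := ((n - k) * k)%N; pose c := lower_const n k.
have c0 : (0 < c)%N.
  by rewrite !muln_gt0 expn_gt0 !muln_gt0 hk (leq_trans hk hkn).
have cR0 : 0 < c%:R :> R by rewrite ltr0n.
exists c%:R^-1, (D ^ D.+2).+1%:R; rewrite invr_gt0 cR0 ltr0n; do 2![split=> //].
move=> F m I N A m0 [idI _] suppI.
have [XGr|XNGr] := pselect (X_is_Gr m hkn A).
  left; split=> //; rewrite mulrC ler_pdivrMr // -natrM mulnC.
  have := rich_everywhere_lower_bound hk m0 idI suppI XGr.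
  rewrite -(ler_nat R) !natrX => H.
  have k0 : k%:R != 0 :> R by rewrite pnatr_eq0 -lt0n.
  (* Taking [k]-th roots turns the integral inequality into the one with exponent [n / k]. *)
  have := @ge0_ler_powR R k%:R^-1 _ _ _ _ _ H.
  rewrite !invr_ge0 ler0n !nnegrE !exprn_ge0 ?ler0n // => /(_ isT isT isT).
  by rewrite -!powR_mulrn ?ler0n // -!powRrM mulfV // powRr1 ?ler0n.
right; have mm : (0 < 2 * m)%N by rewrite muln_gt0.
have mR0 : 0 < m%:R :> R by rewrite ltr0n.
have [mN|Nm] := leqP m N; last first.
  (* For [m > N] no direction is [2 * m]-rich, so the empty hypersurface of degree 0 will do. *)
  exists 0%N, 1; split.
  - by split; [exact: dhomog1 | rewrite rmorph1; apply/eqP; exact: oner_neq0].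
  - by rewrite mulr_ge0 // divr_ge0.
  - move=> w /(Sigma_leq_dim hkn A idI suppI mm); lia.
have [s [fg min0]] : exists s fg, Phi_minor (m := m) hkn A s fg != 0.
  apply: contrapT => no_min; apply: XNGr => s p [a ->].
  apply: big1 => fg _; apply/eqP; rewrite mulf_eq0; apply/orP; right.
  by apply: contrapT => /negP min0; apply: no_min; exists s, fg.
have [d [G [GH dm Gw]]] := low_degree_hypersurface m0 idI suppI mN min0.
exists d, G; split=> //.
by rewrite mulrA ler_pdivlMr // -!natrM ler_nat.
Qed.
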